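(* Let $X$ be an ultrahomogeneous LOTS and $G=(\mathrm{Aut}\,X,\tau_p)$. Then: - $b_rG=b_{c_mX}G$; - $e_{c_mX}G\ge b_{c_mX}G$; - $b_{cX}G=b_{c_mX}G/0_K$ (in particular $b_{c_mX}G\ge b_{cX}G$), where $0_K=\{A,B\}$ with $A=(c_mX\times\{\inf\})\cup(\{\sup\}\times c_mX)$, $B=(\{\inf\}\times c_mX)\cup(c_mX\times\{\sup\})$; - $e_{cX}G=e_{c_mX}G/I$ (in particular $e_{c_mX}G\ge e_{cX}G$), where $I=\{f_y^-\mid y\in c_mX\setminus\{\sup\}\}\cup\{f_z^+\mid z\in c_mX\setminus\{\inf\}\}$, with $f_y^-(x)=\inf$ for $x\le y$, $f_y^-(x)=\sup$ for $x>y$, and $f_z^+(x)=\inf$ for $x<z$, $f_z^+(x)=\sup$ for $x\ge z$; - $b_{c_mX}G$ and $e_{cX}G$ are incomparable; - $b_{cX}G$ and $e_{cX}G$ are incomparable.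
   Context: $X$ is an infinite linearly ordered set with the order topology (LOTS), ultrahomogeneous: for every $n$ and all $x_1<\dots<x_n$, $y_1<\dots<y_n$ in $X$ there is an order automorphism $g\in\mathrm{Aut}\,X$ with $g(x_i)=y_i$. $\tau_p$ is the topology of pointwise convergence on $\mathrm{Aut}\,X$ (a group topology making the action on $X$ continuous). $c_mX$ is the least linearly ordered compactification of $X$: every gap (also improper) of $X$ is replaced by a point with the natural extension of the order; $\inf$ and $\sup$ are its least and greatest points. $cX$ is obtained from $c_mX$ by identifying $\inf$ and $\sup$. $G$ acts naturally on both. For $T=c_mX$ or $cX$: $e_TG$ (Ellis compactification) is the closure of $\{t\mapsto gt\mid g\in G\}$ in $T^T$ (product topology); $b_TG$ (graph compactification) is the closure of $\{\{(t,gt)\mid t\in T\}\mid g\in G\}$ in the space of closed subsets of $T\times T$ with the Vietoris topology. $b_rG$ is the Roelcke compactification: the Samuel compactification of $G$ with respect to the uniformity with base of covers $\{OgO\mid g\in G\}$, $O$ a neighbourhood of $e$. For compactifications of $G$: $b'G\ge bG$ iff there is a continuous map $b'G\to bG$ commuting with the embeddings of $G$; $=$ means both $\ge$ and $\le$; incomparable means neither $\ge$ nor $\le$. $b_{c_mX}G/0_K$ is the quotient space collapsing the two-point set $0_K$ to a point; $I$ is a closed ideal of the semigroup $e_{c_mX}G$ (composition of maps) and $e_{c_mX}G/I$ is the Rees quotient (collapsing $I$ to a point). *)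

(* Defs.v *)
From HB Require Import structures.
From mathcomp Require Import all_boot all_order all_algebra generic_quotient.
From mathcomp Require Import all_classical reals topology.
Import numFieldTopology.Exports.

Set Implicit Arguments.
Unset Strict Implicit.
Unset Printing Implicit Defensive.

Import Order.TTheory GRing.Theory Num.Theory.

Local Open Scope quotient_scope.
Local Open Scope order_scope.
Local Open Scope classical_set_scope.

Lemma order_cvg d (X : orderTopologicalType d) (F : set_system X) (z : X) :
  Filter F ->
  (forall a, a < z -> \forall y \near F, a < y) ->
  (forall b, z < b -> \forall y \near F, y < b) ->
  F --> z.
Proof.
move=> FF Fl Fr U; rewrite itv_nbhsE => -[[l r] [oi zi] /filterS]; apply.
case: l r oi zi => [[] l|[]] [[] r|[]] //= _.
- rewrite in_itv /= => /andP[lz zr].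
  apply: filterS (filterI (Fl l lz) (Fr r zr)) => y [/= ly yr].
  by rewrite in_itv /= ly.
- rewrite in_itv /= andbT => lz.
  by apply: filterS (Fl l lz) => y /=; rewrite in_itv /= andbT.
- rewrite in_itv /= => zr.
  by apply: filterS (Fr r zr) => y /=; rewrite in_itv /=.
- by move=> _; apply: filterE => y; rewrite /= in_itv.
Qed.

Lemma ptws_cvg (U : Type) (V : topologicalType) (F : set_system {ptws U -> V})
    (f : {ptws U -> V}) :
  Filter F -> (forall t : U, (fun g : {ptws U -> V} => g t) @ F --> f t) ->
  F --> f.
Proof.
move=> FF h; apply/cvg_sup => t.
move=> W /= [_ [[B oB <-]] /= Bft /filterS]; apply.
by apply: (h t); exact: open_nbhs_nbhs.
Qed.

Lemma ptws_eval_continuous (U : Type) (V : topologicalType) (t : U) :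
  continuous (fun g : {ptws U -> V} => g t).
Proof.
move=> f W /= Wft.
have /cvg_sup/(_ t) : nbhs f --> f by [].
apply; rewrite nbhsE in Wft; case: Wft => B [oB Bf] BW.
exists ((fun g : {ptws U -> V} => g t) @^-1` B); split => //.
- by exists B.
- by move=> g /BW.
Qed.

(* The library has topological groups only in additive notation. *)
HB.mixin Record Group_isTopological G of Topological G & Group G := {
  mulg_continuous : continuous (fun xy : G * G => (xy.1 * xy.2)%g);
  invg_continuous : continuous (fun x : G => x^-1%g)
}.

#[short(type="topGroupType")]
HB.structure Definition TopGroup :=
  {G of Topological G & Group G & Group_isTopological G}.

Section Aut.
Context {d : Order.disp_t} (X : orderTopologicalType d).

Record aut := Aut {
  aut_fun :> X -> X;
  aut_bij : bijective aut_fun;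
  aut_le : {mono aut_fun : x y / x <= y}
}.

Lemma aut_eqP (g h : aut) : g =1 h -> g = h.
Proof.
case: g h => [g gb gl] [h hb hl] /= /funext gh; rewrite gh in gb gl *.
by congr Aut; exact: Prop_irrelevance.
Qed.

HB.instance Definition _ := gen_eqMixin aut.
HB.instance Definition _ := gen_choiceMixin aut.

Definition aut_one : aut :=
  @Aut id (Bijective (fun=> erefl) (fun=> erefl)) (fun _ _ => erefl).

Lemma aut_mul_le (g h : aut) : {mono g \o h : x y / x <= y}.
Proof. by move=> x y; rewrite /= !aut_le. Qed.

Definition aut_mul (g h : aut) : aut :=
  Aut (bij_comp (aut_bij g) (aut_bij h)) (@aut_mul_le g h).

Lemma aut_inv_ex (g : aut) : {h : X -> X | cancel g h & cancel h g}.
Proof. by apply/cid2; case: (aut_bij g) => h; exists h. Qed.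

Definition aut_inv_fun (g : aut) : X -> X := s2val (aut_inv_ex g).

Lemma autK (g : aut) : cancel g (aut_inv_fun g).
Proof. exact: (s2valP (aut_inv_ex g)). Qed.

Lemma autVK (g : aut) : cancel (aut_inv_fun g) g.
Proof. exact: (s2valP' (aut_inv_ex g)). Qed.

Lemma aut_inv_le (g : aut) : {mono aut_inv_fun g : x y / x <= y}.
Proof. by move=> x y; rewrite -(aut_le g) !autVK. Qed.

Definition aut_inv (g : aut) : aut :=
  Aut (Bijective (autVK g) (autK g)) (@aut_inv_le g).

Lemma aut_mulA : associative aut_mul. Proof. by move=> g h k; exact: aut_eqP. Qed.
Lemma aut_mul1 : left_id aut_one aut_mul. Proof. by move=> g; exact: aut_eqP. Qed.
Lemma aut_1mul : right_id aut_one aut_mul. Proof. by move=> g; exact: aut_eqP. Qed.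
Lemma aut_mulV : left_inverse aut_one aut_inv aut_mul.
Proof. by move=> g; apply: aut_eqP => x /=; rewrite autK. Qed.
Lemma aut_Vmul : right_inverse aut_one aut_inv aut_mul.
Proof. by move=> g; apply: aut_eqP => x /=; rewrite autVK. Qed.

HB.instance Definition _ :=
  isGroup.Build aut aut_mulA aut_mul1 aut_1mul aut_mulV aut_Vmul.

(* The topology of pointwise convergence, for the order topology of X. *)
Definition aut_ptws (g : aut) : {ptws X -> X} := g.

HB.instance Definition _ := Topological.copy aut (initial_topology aut_ptws).

Lemma aut_lt (g : aut) : {mono g : x y / x < y}.
Proof. exact: leW_mono (aut_le g). Qed.

Lemma aut_eval_continuous x : continuous (fun g : aut => g x).
Proof.
move=> g; apply: (@continuous_comp aut _ X aut_ptws (fun h => h x)).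
  exact: initial_continuous.
exact: ptws_eval_continuous.
Qed.

Lemma aut_cvg (T : topologicalType) (f : T -> aut) (t : T) :
  (forall x, (fun s => f s x) @ t --> f t x) -> f @ t --> f t.
Proof.
move=> h U [/= _ [[W oW <-]] /= Wft /filterS]; apply.
have : (aut_ptws \o f) @ t --> aut_ptws (f t) by apply: ptws_cvg => x; exact: h.
by apply; exact: open_nbhs_nbhs.
Qed.

Lemma near_gt (a z : X) : a < z -> \forall y \near z, a < y.
Proof.
move=> az; apply: (@open_nbhs_nbhs _ z [set y | a < y]); split => //.
by have := @rray_open _ X a; rewrite set_itvE.
Qed.

Lemma near_lt (b z : X) : z < b -> \forall y \near z, y < b.
Proof.
move=> az; apply: (@open_nbhs_nbhs _ z [set y | y < b]); split => //.
by have := @lray_open _ X b; rewrite set_itvE.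
Qed.

Lemma near_ge (g : aut) (a y : X) : a < g y ->
  exists2 p, a < g p & \forall z \near y, p <= z.
Proof.
move=> agy; have ay : aut_inv g a < y by rewrite -(aut_lt g) autVK.
have [[p /andP[ap py]]|np] := pselect (exists p, aut_inv g a < p < y).
  exists p; first by rewrite -(aut_lt (aut_inv g)) /= autK.
  by apply: filterS (near_gt py) => z; exact: ltW.
exists y => //; apply: filterS (near_gt ay) => z az.
by rewrite leNgt; apply/negP => zy; apply: np; exists z; rewrite az.
Qed.

Lemma near_le (g : aut) (b y : X) : g y < b ->
  exists2 p, g p < b & \forall z \near y, z <= p.
Proof.
move=> gyb; have yb : y < aut_inv g b by rewrite -(aut_lt g) autVK.
have [[p /andP[yp pb]]|np] := pselect (exists p, y < p < aut_inv g b).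
  exists p; first by rewrite -(aut_lt (aut_inv g)) /= autK.
  by apply: filterS (near_lt yp) => z; exact: ltW.
exists y => //; apply: filterS (near_lt yb) => z az.
by rewrite leNgt; apply/negP => zy; apply: np; exists z; rewrite az andbT.
Qed.

Lemma aut_mul_continuous : continuous (fun gh : aut * aut => (gh.1 * gh.2)%g).
Proof.
move=> [g h]; apply: (@aut_cvg _ (fun gh : aut * aut => (gh.1 * gh.2)%g)) => x.
apply: order_cvg => [a|b] /=.
- move=> /near_ge[p agp px].
  have Ng := aut_eval_continuous (near_gt agp).
  have Nh := aut_eval_continuous px.
  exists ([set k : aut | a < k p], [set k : aut | p <= k x]) => // -[k l] /= [ak pl].
  by apply: lt_le_trans ak _; rewrite aut_le.
- move=> /near_le[p gpb px].
  have Ng := aut_eval_continuous (near_lt gpb).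
  have Nh := aut_eval_continuous px.
  exists ([set k : aut | k p < b], [set k : aut | k x <= p]) => // -[k l] /= [kb lp].
  by apply: le_lt_trans kb; rewrite aut_le.
Qed.

Lemma aut_inv_continuous : continuous (fun g : aut => g^-1%g).
Proof.
move=> g; apply: (@aut_cvg _ (fun g : aut => g^-1%g)) => x.
apply: (@order_cvg _ X) => [|a|b] /=.
- by apply: fmap_filter; exact: nbhs_filter.
- rewrite -(aut_lt g) /= autVK => /near_lt/aut_eval_continuous.
  by apply: (@filterS aut (nbhs g) (nbhs_filter g)) => h /= hax; rewrite -(aut_lt h) autVK.
- rewrite -(aut_lt g) /= autVK => /near_gt/aut_eval_continuous.
  by apply: (@filterS aut (nbhs g) (nbhs_filter g)) => h /= hax; rewrite -(aut_lt h) autVK.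
Qed.

HB.instance Definition _ :=
  Group_isTopological.Build aut aut_mul_continuous aut_inv_continuous.

Definition ultrahomogeneous :=
  forall (n : nat) (x y : n.-tuple X), sorted <%O x -> sorted <%O y ->
    exists g : aut, forall i : 'I_n, g (tnth x i) = tnth y i.

End Aut.

Section Roelcke.
Context {G : topGroupType}.

Definition double_coset (O : set G) (g : G) : set G :=
  [set (a * g * b)%g | a in O & b in O].

(* A cover of the base {O g O | g} gives the entourage made of the pairs of
   points that lie in a common member of the cover. *)
Definition roelcke : Type := G.
HB.instance Definition _ := Choice.on roelcke.

Definition roelcke_entourage : set_system (roelcke * roelcke) :=
  filter_from [set O : set G | nbhs (1%g : G) O]
    (fun O => \bigcup_g (double_coset O g `*` double_coset O g)).

Lemma sub_double_coset (O P : set G) g :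
  O `<=` P -> double_coset O g `<=` double_coset P g.
Proof. by move=> OP x [a Oa [b Ob <-]]; exists a; [exact: OP|exists b; [exact: OP|]]. Qed.

Lemma roelcke_filter : Filter roelcke_entourage.
Proof.
apply: filter_from_filter; first by exists setT; exact: filterT.
move=> O P nO nP; exists (O `&` P); first exact: filterI.
move=> [x y] [g _ [/= xg yg]].
have sO := @sub_double_coset (O `&` P) O g (@subIsetl _ _ _).
have sP := @sub_double_coset (O `&` P) P g (@subIsetr _ _ _).
by split; exists g => //; split => /=; (apply: sO || apply: sP).
Qed.

Lemma roelcke_diagonal A : roelcke_entourage A -> diagonal `<=` A.
Proof.
move=> [O nO OA] [x y] /diagonalP ->; apply: OA; exists y => //.
have O1 := nbhs_singleton nO.
by split; exists 1%g => //; exists 1%g; rewrite // mul1g mulg1.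
Qed.

Lemma roelcke_inv A : roelcke_entourage A -> roelcke_entourage A^-1%relation.
Proof.
by move=> [O nO OA]; exists O => // -[x y] [g _ [xg yg]]; apply: OA; exists g.
Qed.

Lemma nbhs1_mul (O : set G) : nbhs (1%g : G) O ->
  exists2 V, nbhs (1%g : G) V & forall a b, V a -> V b -> O (a * b)%g.
Proof.
rewrite -{1}(mulg1 (1%g : G)) => nO.
have [[A B] [/= nA nB] AB] := @mulg_continuous G (1%g, 1%g) O nO.
exists (A `&` B); first exact: filterI.
by move=> a b [Aa _] [_ Bb]; exact: (AB (a, b)).
Qed.

Lemma nbhs1_split (O : set G) : nbhs (1%g : G) O ->
  exists2 V, nbhs (1%g : G) V &
    forall a b c, V a -> V b -> V c -> O (a * b^-1 * c)%g.
Proof.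
move=> /nbhs1_mul[V nV VO]; have [W nW WV] := nbhs1_mul nV.
have nW' : nbhs (1%g : G) [set b : G | W b^-1%g].
  by apply: invg_continuous; rewrite invg1.
exists (V `&` W `&` [set b : G | W b^-1%g]); first by do ?apply: filterI.
by move=> a b c [[_ Wa] _] [_ Wb] [[Vc _] _]; apply: VO => //; exact: WV.
Qed.

Lemma roelcke_split A : roelcke_entourage A ->
  exists2 B, roelcke_entourage B & (B \; B `<=` A)%relation.
Proof.
move=> [O nO OA]; have [V nV VO] := nbhs1_split nO.
exists (\bigcup_g (double_coset V g `*` double_coset V g)).
  by exists V.
have V1 := nbhs_singleton nV.
move=> [x z] [y /= [g _ [/= xg yg]] [h _ [/= yh zh]]].
apply: OA; exists y => //.
have key t u : double_coset V u y -> double_coset V u t -> double_coset O y t.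
  move=> [a Va [b Vb <-]] [a' Va' [b' Vb' <-]].
  exists (a' * a^-1)%g; first by rewrite -[(a' * a^-1)%g]mulg1; exact: VO.
  exists (b^-1 * b')%g; first by rewrite -[(b^-1)%g]mul1g; exact: VO.
  by rewrite !mulgA mulgVK mulgK.
by split; [exact: key xg|exact: key zh].
Qed.

HB.instance Definition _ := isUniform.Build roelcke
  roelcke_filter roelcke_diagonal roelcke_inv roelcke_split.

End Roelcke.
Arguments roelcke : clear implicits.

(* Compactifications of G are handled through a space and a map from G with
   dense image; their order refers to nothing else. *)
Record dense_extension (G : Type) := DenseExtension {
  ext_space :> topologicalType;
  ext_emb : G -> ext_space;
  ext_dense : dense (range ext_emb)
}.

Section Extensions.
Context {G : Type}.
Implicit Types b : dense_extension G.

Definition ext_ge b' b : Prop :=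
  exists2 h : b' -> b, continuous h & forall g, h (ext_emb b' g) = ext_emb b g.

Definition ext_eq b' b : Prop := ext_ge b' b /\ ext_ge b b'.

Definition ext_incomparable b' b : Prop := ~ ext_ge b' b /\ ~ ext_ge b b'.

Section Closure.
Context {Z : topologicalType} (i : G -> Z).

Lemma closure_embP g : i g \in closure (range i).
Proof. by apply/mem_set/subset_closure; exists g. Qed.

Definition closure_emb (g : G) : closure (range i) :=
  exist _ (i g) (closure_embP g).

Lemma closure_emb_dense : dense (range closure_emb).
Proof.
move=> O [[z zi] Oz] [U oU UO]; have zc := set_mem zi.
have Uz : U z by rewrite -UO in Oz.
have [_ [[g _ <-] Ug]] := zc U (open_nbhs_nbhs (conj oU Uz)).
exists (closure_emb g); split; last by exists g.
by rewrite -UO.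
Qed.

Definition closure_extension : dense_extension G :=
  DenseExtension closure_emb_dense.

End Closure.
End Extensions.

Section Collapse.
Context {T : topologicalType} (A : set T).

(* The quotient space of T in which A becomes one point. *)
Definition collapse_rel : rel T := fun x y => `[< x = y \/ A x /\ A y >].

Lemma collapse_rel_refl : reflexive collapse_rel.
Proof. by move=> x; apply/asboolP; left. Qed.

Lemma collapse_rel_sym : symmetric collapse_rel.
Proof. by move=> x y; apply/asboolP/asboolP => -[->|[]]; by [left|right]. Qed.

Lemma collapse_rel_trans : transitive collapse_rel.
Proof.
move=> y x z /asboolP[->//|[Ax Ay]] /asboolP[<-|[_ Az]]; apply/asboolP; by right.
Qed.

Canonical collapse_equiv :=
  EquivRel collapse_rel collapse_rel_refl collapse_rel_sym collapse_rel_trans.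

Definition collapse : topologicalType :=
  quotient_topology {eq_quot collapse_equiv}.

Definition collapse_pi (x : T) : collapse := \pi_{eq_quot collapse_equiv} x.

Lemma collapse_pi_continuous : continuous collapse_pi.
Proof. exact: (@pi_continuous T {eq_quot collapse_equiv}). Qed.

Lemma collapse_eqP x y : collapse_pi x = collapse_pi y <-> (x = y \/ A x /\ A y).
Proof.
split=> [/(@eqquotP _ _ {eq_quot collapse_equiv})/asboolP//|h].
by apply/(@eqquotP _ _ {eq_quot collapse_equiv})/asboolP.
Qed.

Definition collapse_repr (q : collapse) : T :=
  repr (q : {eq_quot collapse_equiv}).

Lemma collapse_reprK : cancel collapse_repr collapse_pi.
Proof. exact: (@reprK T {eq_quot collapse_equiv}). Qed.

Lemma collapse_openP (U : set collapse) : open U <-> open (collapse_pi @^-1` U).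
Proof. by []. Qed.

Lemma collapse_continuous {Z : topologicalType} (f : collapse -> Z) :
  continuous (f \o collapse_pi) -> continuous f.
Proof. by move/(@quotient_continuous T {eq_quot collapse_equiv}). Qed.

Definition collapse_map (f : T -> T) : collapse -> collapse :=
  collapse_pi \o f \o collapse_repr.

Lemma collapse_map_pi (f : T -> T) x : A `<=` f @^-1` A ->
  collapse_map f (collapse_pi x) = collapse_pi (f x).
Proof.
move=> fA; rewrite /collapse_map /=; apply/collapse_eqP.
have /collapse_eqP[->|[h1 h2]] := collapse_reprK (collapse_pi x); first by left.
by right; split; exact: fA.
Qed.

Lemma collapse_map_continuous (f : T -> T) : A `<=` f @^-1` A ->
  continuous f -> continuous (collapse_map f).
Proof.
move=> fA cf; apply: collapse_continuous.
rewrite (_ : _ \o _ = collapse_pi \o f).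
  by move=> x; apply: continuous_comp; [exact: cf|exact: collapse_pi_continuous].
by apply/funext => x; rewrite /comp collapse_map_pi.
Qed.

End Collapse.

Lemma collapse2_hausdorff (T : topologicalType) (a b : T) :
  hausdorff_space T -> hausdorff_space (collapse [set a; b]).
Proof.
rewrite !open_hausdorff => hT.
have sep (x y : T) : x <> y -> exists UV : set T * set T,
    [/\ open UV.1, open UV.2, UV.1 x, UV.2 y & UV.1 `&` UV.2 = set0].
  move=> /eqP/hT[[U V]] /= [/set_mem Ux /set_mem Vy] [oU oV /eqP UV].
  by exists (U, V).
have main (x y : T) : ~ [set a; b] x -> x <> y ->
    exists UV : set (collapse [set a; b]) * set (collapse [set a; b]),
    [/\ open UV.1, open UV.2, UV.1 (collapse_pi _ x), UV.2 (collapse_pi _ y)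
      & UV.1 `&` UV.2 = set0].
  move=> nAx xy.
  have [[U1 V1] /= [oU1 oV1 U1x V1y UV1]] := sep _ _ xy.
  have [|[U2 V2] /= [oU2 oV2 U2x V2y UV2]] := sep x a.
    by move=> xa; apply: nAx; left.
  have [|[U3 V3] /= [oU3 oV3 U3x V3y UV3]] := sep x b.
    by move=> xa; apply: nAx; right.
  pose U := U1 `&` U2 `&` U3; pose V := V1 `|` V2 `|` V3.
  have UV z : U z -> V z -> False.
    move=> [[u1 u2] u3] [[v1|v2]|v3].
    - by have : (U1 `&` V1) z by []; rewrite UV1.
    - by have : (U2 `&` V2) z by []; rewrite UV2.
    - by have : (U3 `&` V3) z by []; rewrite UV3.
  have AV z : [set a; b] z -> V z by move=> [->|->]; [left; right|right].
  exists (collapse_pi _ @` U, collapse_pi _ @` V) => /=; split.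
  - apply/collapse_openP; rewrite (_ : _ @^-1` _ = U); last first.
      apply/seteqP; split=> z; last by exists z.
      move=> [t Ut] /collapse_eqP[<-//|[At _]].
      by case: (UV t Ut (AV t At)).
    by do 2 ?apply: openI.
  - apply/collapse_openP; rewrite (_ : _ @^-1` _ = V); last first.
      apply/seteqP; split=> z; last by exists z.
      by move=> [t Ut] /collapse_eqP[<-//|[_ Az]]; exact: AV.
    by do 2 ?apply: openU.
  - by exists x.
  - by exists y => //; left; left.
  - rewrite -subset0 => _ [[u Uu <-] [v Vv /collapse_eqP h]].
    have Vu : V u by case: h => [<-//|[_ /AV]].
    exact: UV Uu Vu.
move=> p q /eqP pq.
rewrite -(collapse_reprK p) -(collapse_reprK q) in pq *.
set x := collapse_repr p in pq *; set y := collapse_repr q in pq *.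
have xy : x <> y by move=> xy; apply: pq; rewrite xy.
have [Ax|nAx] := pselect ([set a; b] x).
  have nAy : ~ [set a; b] y.
    by move=> Ay; apply: pq; apply/collapse_eqP; right.
  have [|[U V] /= [oU oV Uy Vx UV]] := main y x nAy; first by move/esym.
  exists (V, U) => /=; first by rewrite !inE.
  by split => //; rewrite setIC UV.
have [[U V] /= [oU oV Ux Vy UV]] := main x y nAx xy.
exists (U, V) => /=; first by rewrite !inE.
by split => //; rewrite UV.
Qed.

Section CollapseExtension.
Context {G : Type} (b : dense_extension G) (A : set b).

Definition collapse_emb (g : G) : collapse A := collapse_pi A (ext_emb b g).

Lemma collapse_emb_dense : dense (range collapse_emb).
Proof.
move=> O [q Oq] /collapse_openP oO.
have [|t [Ot [g _ gt]]] := @ext_dense _ b (collapse_pi A @^-1` O) _ oO.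
  by exists (collapse_repr q); rewrite /= collapse_reprK.
rewrite -gt in Ot; by exists (collapse_emb g); split => //; exists g.
Qed.

Definition collapse_extension : dense_extension G :=
  DenseExtension collapse_emb_dense.

End CollapseExtension.

Section Hyperspace.
Context (Y : topologicalType).

Record hyperspace := Hyperspace {
  hyper_set :> set Y;
  hyper_closed : closed hyper_set
}.

HB.instance Definition _ := gen_eqMixin hyperspace.
HB.instance Definition _ := gen_choiceMixin hyperspace.

(* Index (true, U) gives the closed sets included in U, and (false, U) gives
   the closed sets that meet U. *)
Definition vietoris_subbase (i : bool * set Y) : set hyperspace :=
  if i.1 then [set F : hyperspace | F `<=` i.2]
  else [set F : hyperspace | F `&` i.2 !=set0].

HB.instance Definition _ := @isSubBaseTopological.Build hyperspace
  (bool * set Y)%type [set i | open i.2] vietoris_subbase.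

End Hyperspace.

Section Samuel.
Context (R : realType) (U : uniformType).

(* The Samuel compactification is the closure of U under the evaluation into
   the product of lines indexed by the bounded uniformly continuous functions. *)
Record ucb_fun := UcbFun {
  ucb_val :> U -> R;
  ucb_unif_continuous : unif_continuous ucb_val;
  ucb_bounded : exists M : R, forall x, (`|ucb_val x| <= M)%R
}.

Definition samuel_map (x : U) : {ptws ucb_fun -> R} := fun f => f x.

Definition samuel : dense_extension U := closure_extension samuel_map.

End Samuel.

Definition roelcke_compactification (R : realType) (G : topGroupType) :
  dense_extension G := samuel R (roelcke G).

Section Ellis.
Context {G : Type} {T : topologicalType} (act : G -> T -> T).

Definition ellis_map (g : G) : {ptws T -> T} := act g.

Definition ellis_compactification : dense_extension G :=
  closure_extension ellis_map.

End Ellis.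

Definition closed_ideal {T : topologicalType} (S I : set {ptws T -> T}) : Prop :=
  [/\ (forall f h, S f -> S h -> S (f \o h)),
      I `<=` S, I !=set0, closed I
    & forall f h, S f -> I h -> I (f \o h) /\ I (h \o f)].

Section Graph.
Context {G : Type} {T : topologicalType} (act : G -> T -> T).
Hypothesis T_hausdorff : hausdorff_space T.
Hypothesis act_continuous : forall g, continuous (act g).

Definition graph (f : T -> T) : set (T * T) := [set p | p.2 = f p.1].

Lemma graph_closed g : closed (graph (act g)).
Proof.
move=> [x y] cxy; apply: contrapT => /= /eqP.
move: (T_hausdorff); rewrite open_hausdorff => hT /hT[[U V]] /=.
move=> [/set_mem Uy /set_mem Vx] [oU oV /eqP UV].
have [|[s t] [gst [/= Vs Ut]]] := cxy (act g @^-1` V `*` U).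
- exists (act g @^-1` V, U) => //; split => /=; last exact: open_nbhs_nbhs.
  by apply: act_continuous; exact: open_nbhs_nbhs.
- rewrite /graph /= in gst; rewrite gst in Ut.
  by have : (U `&` V) (act g s) by []; rewrite UV.
Qed.

Definition graph_map (g : G) : hyperspace (T * T)%type :=
  Hyperspace (@graph_closed g).

Definition graph_compactification : dense_extension G :=
  closure_extension graph_map.

End Graph.

Section LeastCompactification.
Context {d : Order.disp_t} (X : orderTopologicalType d).

(* The gap (L, ~` L): no greatest element below and no least element above. L
   may be empty (no least element in X) or full (no greatest element). *)
Definition gap (L : set X) : Prop :=
  [/\ (forall x y, x <= y -> L y -> L x),
      (forall x, L x -> exists2 y, L y & x < y)
    & (forall x, ~ L x -> exists2 y, ~ L y & y < x)].

(* c_m X. A point x of X is represented by the ray of the y <= x, and a gap by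
   its lower part; the order is inclusion. *)
Record cm := Cm {
  cm_set : set X;
  cm_setP : (exists x, cm_set = [set y | y <= x]) \/ gap cm_set
}.

Lemma cm_eqP (s t : cm) : cm_set s = cm_set t -> s = t.
Proof.
case: s t => [S Sp] [U Up] /= SU; rewrite SU in Sp *.
by congr Cm; exact: Prop_irrelevance.
Qed.

HB.instance Definition _ := gen_eqMixin cm.
HB.instance Definition _ := gen_choiceMixin cm.

Definition cm_le (s t : cm) : bool := `[< cm_set s `<=` cm_set t >].

Lemma cm_le_refl : reflexive cm_le.
Proof. by move=> s; apply/asboolP. Qed.

Lemma cm_le_anti : antisymmetric cm_le.
Proof.
by move=> s t /andP[/asboolP st /asboolP ts]; apply/cm_eqP/seteqP.
Qed.

Lemma cm_le_trans : transitive cm_le.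
Proof.
by move=> t s u /asboolP st /asboolP tu; apply/asboolP => x /st/tu.
Qed.

HB.instance Definition _ :=
  Order.Le_isPOrder.Build d cm cm_le_refl cm_le_anti cm_le_trans.

Lemma cm_leE (s t : cm) : (s <= t) = `[< cm_set s `<=` cm_set t >].
Proof. by []. Qed.

Lemma cm_lower (s : cm) x y : x <= y -> cm_set s y -> cm_set s x.
Proof.
case: s => S [[z /= ->]|[+ _ _]] /=; first exact: le_trans.
exact.
Qed.

Lemma cm_le_total : total (<=%O : rel cm).
Proof.
move=> s t; apply/orP; have [st|/existsNP[x /not_implyP[sx tx]]] :=
  pselect (cm_set s `<=` cm_set t); first by left; apply/asboolP.
right; apply/asboolP => y ty; apply: cm_lower sx.
by rewrite leNgt; apply/negP => /ltW xy; apply: tx; exact: cm_lower ty.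
Qed.

HB.instance Definition _ := Order.POrder_isTotal.Build d cm cm_le_total.

Lemma cm_botP : let L := [set y : X | forall x, y <= x] in
  (exists x, L = [set y | y <= x]) \/ gap L.
Proof.
have [[m mP]|nm] := pselect (exists m : X, forall x, m <= x).
  left; exists m; apply/seteqP; split=> y /=; first exact.
  by move=> ym x; exact: le_trans ym (mP x).
right; split=> [x y xy yP z|x xP|x /existsNP[y /negP]].
- exact: le_trans xy (yP z).
- by case: nm; exists x.
- by rewrite -ltNge => yx; exists y => // yP; apply: nm; exists y.
Qed.

Lemma cm_topP : (exists x : X, setT = [set y | y <= x]) \/ gap (@setT X).
Proof.
have [[m mP]|nm] := pselect (exists m : X, forall x, x <= m).
  by left; exists m; apply/seteqP; split=> y /=.
right; split=> // [x _|x []//]; apply: contrapT => h; apply: nm; exists x => y.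
by rewrite leNgt; apply/negP => xy; apply: h; exists y.
Qed.

Lemma cm_le0s (s : cm) : Cm cm_botP <= s.
Proof.
apply/asboolP => /= y yP; case: s => S [[x /= ->]|[low _ nmin]] /=; first exact: yP.
apply: contrapT => Sy; have [z _] := nmin y Sy.
by rewrite ltNge yP.
Qed.

Lemma cm_les1 (s : cm) : s <= Cm cm_topP.
Proof. exact/asboolP. Qed.

HB.instance Definition _ := Order.hasBottom.Build d cm cm_le0s.
HB.instance Definition _ := Order.hasTop.Build d cm cm_les1.

HB.instance Definition _ := OrderTopological.copy cm (order_topology cm).

Lemma cm_act_subproof (g : aut X) (s : cm) :
  let L := g @` cm_set s in (exists x, L = [set y | y <= x]) \/ gap L.
Proof.
have im (S : set X) y : (g @` S) y <-> S (g^-1%g y).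
  split=> [[x Sx <-]|Sy]; first by rewrite /= autK.
  by exists (g^-1%g y) => //=; rewrite autVK.
case: s => S [[x /= ->]|[low nmax nmin]] /=; [left|right].
  exists (g x); apply/seteqP; split=> y; rewrite im /=.
    by move=> h; rewrite -(aut_le g^-1%g) /= autK.
  by move=> h; rewrite -(aut_le g) /= autVK.
split=> [x y xy|x|x]; rewrite !im.
- by apply: low; rewrite aut_le.
- move=> /nmax[y Sy xy]; exists (g y); first by exists y.
  by rewrite -(aut_lt g^-1%g) /= autK.
- move=> /nmin[y Sy xy]; exists (g y); first by rewrite im /= autK.
  by rewrite -(aut_lt g^-1%g) /= autK.
Qed.

Definition cm_act (g : aut X) (s : cm) : cm := Cm (cm_act_subproof g s).

Lemma cm_actK g : cancel (cm_act g) (cm_act g^-1%g).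
Proof.
move=> s; apply: cm_eqP; rewrite /= image_comp -[RHS]image_id.
by apply: eq_imagel => x _ /=; rewrite autK.
Qed.

Lemma cm_actVK g : cancel (cm_act g^-1%g) (cm_act g).
Proof.
move=> s; apply: cm_eqP; rewrite /= image_comp -[RHS]image_id.
by apply: eq_imagel => x _ /=; rewrite autVK.
Qed.

Lemma cm_act_homo g : {homo cm_act g : s t / s <= t}.
Proof. by move=> s t /asboolP st; apply/asboolP; exact: image_subset. Qed.

Lemma cm_act_le g : {mono cm_act g : s t / s <= t}.
Proof.
move=> s t; apply/idP/idP; last exact: cm_act_homo.
by move/(cm_act_homo g^-1%g); rewrite !cm_actK.
Qed.

Lemma cm_act_lt g : {mono cm_act g : s t / s < t}.
Proof. exact: leW_mono (cm_act_le g). Qed.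

Lemma cm_act_bot g : cm_act g \bot = \bot.
Proof.
by apply/eqP; rewrite -lex0 -(cm_act_le g^-1%g) cm_actK le0x.
Qed.

Lemma cm_act_top g : cm_act g \top = \top.
Proof.
by apply/eqP; rewrite -le1x -(cm_act_le g^-1%g) cm_actK lex1.
Qed.

Lemma cm_act_continuous g : continuous (cm_act g).
Proof.
move=> s; apply: (@order_cvg _ cm) => [|a|b] /=.
- by apply: fmap_filter; exact: nbhs_filter.
- rewrite -(cm_act_lt g^-1%g) cm_actK => h.
  have := near_gt h; apply: (@filterS cm _ (nbhs_filter s)) => t /= at_.
  by rewrite -(cm_act_lt g^-1%g) cm_actK.
- rewrite -(cm_act_lt g^-1%g) cm_actK => h.
  have := near_lt h; apply: (@filterS cm _ (nbhs_filter s)) => t /= at_.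
  by rewrite -(cm_act_lt g^-1%g) cm_actK.
Qed.

Definition cX : topologicalType := collapse [set \bot; \top : cm].

Definition cX_act (g : aut X) : cX -> cX := collapse_map (cm_act g).

Lemma cX_act_continuous g : continuous (cX_act g).
Proof.
apply: collapse_map_continuous; last exact: cm_act_continuous.
by move=> s [->|->]; [left; exact: cm_act_bot|right; exact: cm_act_top].
Qed.

Lemma cX_hausdorff : hausdorff_space cX.
Proof. apply: collapse2_hausdorff; exact: order_hausdorff. Qed.

Definition e_cm : dense_extension (aut X) := ellis_compactification cm_act.

Definition e_cX : dense_extension (aut X) := ellis_compactification cX_act.

Definition b_cm : dense_extension (aut X) :=
  graph_compactification (@order_hausdorff _ cm) cm_act_continuous.

Definition b_cX : dense_extension (aut X) :=
  graph_compactification cX_hausdorff cX_act_continuous.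

Definition f_minus (y x : cm) : cm := if x <= y then \bot else \top.

Definition f_plus (z x : cm) : cm := if x < z then \bot else \top.

Definition I_maps : set {ptws cm -> cm} :=
  [set f_minus y | y in [set y | y != \top]] `|`
  [set f_plus z | z in [set z | z != \bot]].

Definition I_ideal : set e_cm := [set f | I_maps (\val f)].

Definition graph_A : set (cm * cm) :=
  ([set: cm] `*` [set \bot]) `|` ([set \top] `*` [set: cm]).

Definition graph_B : set (cm * cm) :=
  ([set \bot] `*` [set: cm]) `|` ([set: cm] `*` [set \top]).

Definition limit_graph (F : b_cm) : set (cm * cm) := hyper_set (\val F).

Definition zero_K : set b_cm :=
  [set F | limit_graph F = graph_A \/ limit_graph F = graph_B].

End LeastCompactification.
Arguments limit_graph {d X} F _.
Arguments I_maps {d} X _.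
Arguments I_ideal {d} X _.
Arguments graph_A {d} X _.
Arguments graph_B {d} X _.
Arguments zero_K {d} X _.

(* Main.v *)
Require Import Defs.
From mathcomp Require Import all_boot all_order all_algebra.
From mathcomp Require Import all_classical reals topology.
From mathcomp Require Import normedtype lra.

(* An ultrafilter on G converges in every compactification, so b' >= b exactly
   when ultrafilters with the same limit in b' have the same limit in b, and it
   remains to describe the limits. In e_{c_m X}G the limit is a monotone map f
   fixing inf and sup; in b_{c_m X}G it is the graph of f with its jumps filled
   by vertical segments, and c_m X -> cX acts on both. Filled graphs agree in
   (cX)^2 only if they are equal or are A and B, and maps into cX agree only if
   they are equal or both take only the values inf and sup. Redefining f at a
   jump changes the map but not the filled graph, whereas all the steps of I
   collapse to one map while their filled graphs stay distinct: this gives the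
   incomparabilities. For the Roelcke compactification, two different filled
   graphs are separated by conditions g x' < y', g x > y with x < x' and y' < y,
   which no double coset OuO mixes when O is small; conversely, if the filled
   graphs are equal, ultrahomogeneity produces a, b in O with h = a g b for some
   g and h arbitrarily far along the two ultrafilters. *)

Set Implicit Arguments.
Unset Strict Implicit.
Unset Printing Implicit Defensive.

Import numFieldTopology.Exports.
Import Order.TTheory GRing.Theory Num.Theory.

Local Open Scope classical_set_scope.

(** Two completed graphs are always told apart through strict inequalities at two arguments [x < y].
    Such inequalities survive small changes in both coordinates, which a comparison of values at one
    argument does not: at a jump the limit map may take any value of the vertical segment. The
    obstacle in the Roelcke case is that [b] is constrained at two finite sets which interleave
    arbitrarily. It has to be close to the identity on a finite set [P], and [h b g^-1] has to be
    close to the identity on [P] too, which prescribes [b] approximately on [g^-1 P]. The common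
    limit graph makes these demands compatible: if [g^-1 p] tends to [z] along the first
    ultrafilter, then [(z, p)] is in the limit graph, so along the second one the graph of [h]
    passes near [(z, p)] and offers an admissible value for [b (g^-1 p)]. This value lies in [c_m X]
    and is moved into [X] by density, since only finitely many strict inequalities have to be
    kept. *)

Lemma fmap_ultra (T U : Type) (f : T -> U) (F : set_system T) :
  UltraFilter F -> UltraFilter (f @ F).
Proof.
move=> FU; split=> [|H HH sFH].
  exact: fmap_proper_filter.
apply/seteqP; split=> // A HA.
have [//|FnA] := in_ultra_setVsetC (f @^-1` A) FU.
have /sFH HnA : (f @ F) (~` A) by [].
by have [x []] := filter_ex (filterI HA HnA).
Qed.

Lemma filter_seq (T : Type) (I : eqType) (F : set_system T) (s : seq I)
    (B : I -> set T) :
  Filter F -> (forall i, i \in s -> F (B i)) ->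
  F [set t | forall i, i \in s -> B i t].
Proof.
move=> FF; elim: s => [|i s IH] FB; first by apply: filterE => t i.
have F1 : F (B i) by apply: FB; rewrite inE eqxx.
have F2 : F [set t | forall i, i \in s -> B i t].
  by apply: IH => j js; apply: FB; rewrite inE js orbT.
apply: filterS (filterI F1 F2) => t [Bt st] j.
by rewrite inE => /orP[/eqP->|/st].
Qed.

(** * Comparison of compactifications *)

Section DenseExtensions.
Context {G : Type}.
Implicit Types b : dense_extension G.

Lemma ext_nbhs_ex b (p : b) (N : set b) : nbhs p N -> exists g, N (ext_emb b g).
Proof.
rewrite nbhsE => -[O [oO Op] ON].
have [|x [Ox [g _ gx]]] := @ext_dense _ b O _ oO; first by exists p.
by exists g; apply: ON; rewrite gx.
Qed.

(** A filter [F] on [G] satisfies [ext_emb b @ F --> p] iff it contains this one, so convergence in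
    different compactifications can be compared on [G]. *)
Definition ext_trace b (p : b) : set_system G :=
  filter_from (nbhs p) (fun N => ext_emb b @^-1` N).

Lemma ext_trace_proper b (p : b) : ProperFilter (ext_trace p).
Proof.
apply: filter_from_proper => [|N /ext_nbhs_ex//].
apply: filter_from_filter; first by exists setT; exact: filterT.
by move=> N M pN pM; exists (N `&` M) => //; exact: filterI.
Qed.

Lemma ext_trace_cvg b (p : b) : ext_emb b @ ext_trace p --> p.
Proof. by move=> N pN; exists N. Qed.

Lemma ext_ultra b (p : b) :
  exists2 F : set_system G, UltraFilter F & ext_emb b @ F --> p.
Proof.
have [F [FU sF]] := ultraFilterLemma (ext_trace_proper p).
by exists F => // N pN; apply: sF; exact: ext_trace_cvg.
Qed.

(** The map sends [p] to the limit in [b] of the trace of [p]. That limit exists because all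
    ultrafilters finer than the trace have the same limit; regularity of [b] makes the map
    continuous, since the images of points near [p] fall in the closure of a small neighbourhood. *)
Lemma ext_ge_ultra b' b : regular_space b ->
  (forall F : set_system G, UltraFilter F -> exists q : b, ext_emb b @ F --> q) ->
  (forall (F F' : set_system G) (p : b') (q q' : b),
    UltraFilter F -> UltraFilter F' ->
    ext_emb b' @ F --> p -> ext_emb b' @ F' --> p ->
    ext_emb b @ F --> q -> ext_emb b @ F' --> q' -> q = q') ->
  ext_ge b' b.
Proof.
move=> breg blim buniq.
have trace_lim (p : b') : exists q : b, ext_emb b @ ext_trace p --> q.
  have [F FU Fp] := ext_ultra p; have [q Fq] := blim F FU.
  exists q => W; rewrite nbhsE => -[O [oO Oq] OW].
  have [Ot|nOt] := pselect (ext_trace p (ext_emb b @^-1` O)).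
    by have := ext_trace_proper p => ?; apply: filterS Ot => g /OW.
  (* If the trace does not enter [O], some ultrafilter converges to [p] in [b'] while staying
     outside [O], against uniqueness of the limit. *)
  pose H := filter_from (nbhs p)
    (fun N => ext_emb b' @^-1` N `&` ext_emb b @^-1` (~` O)).
  have HP : ProperFilter H.
    apply: filter_from_proper => [|N pN].
      apply: filter_from_filter; first by exists setT; exact: filterT.
      move=> N M pN pM; exists (N `&` M); first exact: filterI.
      by move=> g [[Ng Mg] Og].
    apply: contrapT => h; apply: nOt; exists N => // g Ng.
    by apply: contrapT => Og; apply: h; exists g.
  have [F' [F'U sF']] := ultraFilterLemma HP.
  have [q' F'q'] := blim F' F'U.
  have F'p : ext_emb b' @ F' --> p.
    by move=> N pN; apply: sF'; exists N => // g [].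
  have qq' := buniq F F' p q q' FU F'U Fp F'p Fq F'q'; subst q'.
  have F'O : F' (ext_emb b @^-1` O).
    by apply: F'q'; exact: open_nbhs_nbhs.
  have F'nO : F' (ext_emb b @^-1` (~` O)).
    by apply: sF'; exists setT; [exact: filterT|move=> g []].
  by have [g []] := filter_ex (filterI F'O F'nO).
pose h p := projT1 (cid (trace_lim p)).
have hP p : ext_emb b @ ext_trace p --> h p by exact: projT2 (cid (trace_lim p)).
exists h => [p W hW|g].
  have [V hV VW] := breg _ _ hW.
  have [N pN NV] := hP p V hV.
  have [O [oO Op] ON] : exists2 O, open_nbhs p O & O `<=` N.
    by rewrite nbhsE in pN.
  suff : nbhs p (h @^-1` W) by [].
  rewrite nbhsE; exists O; first by split.
  move=> p' Op'; apply: VW => C hC.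
  have tC : ext_trace p' (ext_emb b @^-1` C) by exact: hP.
  have tO : ext_trace p' (ext_emb b' @^-1` O).
    by exists O => //; exact: open_nbhs_nbhs.
  have ? := ext_trace_proper p'.
  have [g' [Cg' Og']] := filter_ex (filterI tC tO).
  by exists (ext_emb b g'); split=> //; apply: NV; exact: ON.
have [F [FU sF]] := ultraFilterLemma (ext_trace_proper (ext_emb b' g)).
(* The principal ultrafilter at [g] converges to the image of [g] in both extensions, so uniqueness
   identifies the limit of the trace there. *)
have PU := principal_filter_ultra g.
apply: (buniq F _ (ext_emb b' g) _ _ FU PU).
- by move=> N pN; apply: sF; exact: ext_trace_cvg.
- by move=> N /nbhs_singleton Ng; apply/principal_filterP.
- by move=> N pN; apply: sF; exact: hP.
- by move=> N /nbhs_singleton Ng; apply/principal_filterP.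
Qed.

Lemma ext_ge_trans b1 b2 b3 : ext_ge b1 b2 -> ext_ge b2 b3 -> ext_ge b1 b3.
Proof.
move=> [h hc he] [k kc ke]; exists (k \o h) => [x|g /=].
  by apply: continuous_comp; [exact: hc|exact: kc].
by rewrite he ke.
Qed.

Lemma ext_map_cvg b' b (h : b' -> b) (F : set_system G) (p : b') :
  Filter F -> continuous h -> (forall g, h (ext_emb b' g) = ext_emb b g) ->
  ext_emb b' @ F --> p -> ext_emb b @ F --> h p.
Proof.
move=> FF hc he Fp; rewrite (_ : ext_emb b = h \o ext_emb b'); last first.
  by apply/funext => g /=.
by move=> W hW; exact: (Fp _ (hc p W hW)).
Qed.

Lemma ext_map_unique b' b (h k : b' -> b) :
  hausdorff_space b -> continuous h -> continuous k ->
  (forall g, h (ext_emb b' g) = ext_emb b g) ->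
  (forall g, k (ext_emb b' g) = ext_emb b g) -> h =1 k.
Proof.
move=> hb hc kc he ke p; have [F FU Fp] := ext_ultra p.
have Fh : ext_emb b @ F --> h p by exact: ext_map_cvg Fp.
have Fk : ext_emb b @ F --> k p by exact: ext_map_cvg Fp.
exact: (cvg_unique hb Fh Fk).
Qed.

Lemma closed_bijection_continuous (S T : topologicalType) (f : S -> T)
    (g : T -> S) : compact [set: S] -> hausdorff_space T -> continuous f ->
  cancel g f -> injective f -> continuous g.
Proof.
move=> cS hT fc gK finj; apply/continuous_closedP => C cC.
rewrite (_ : g @^-1` C = f @` C).
  apply: compact_closed => //; apply: continuous_compact.
    by apply: continuous_subspaceT => x; exact: fc.
  by apply: subclosed_compact cC cS _.
apply/seteqP; split=> [y Cy|_ [x Cx <-]]; first by exists (g y).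
by rewrite /= (finj (g (f x)) x).
Qed.

Lemma ext_map_surj b' b (h : b' -> b) :
  compact [set: b'] -> hausdorff_space b -> continuous h ->
  (forall g, h (ext_emb b' g) = ext_emb b g) -> forall q, exists p, h p = q.
Proof.
move=> cb' hb hc he q.
have [F FU Fq] := ext_ultra q.
have := cb'; rewrite compact_ultra => /(_ (ext_emb b' @ F) (fmap_ultra _ FU)).
move=> /(_ filterT)[p [_ Fp]]; exists p.
by apply: (cvg_unique hb _ Fq); apply: ext_map_cvg Fp.
Qed.

(** By [hA], [h] induces an injection of the collapse; it is onto by density and compactness, and a
    continuous bijection from a compact space to a Hausdorff one has a continuous inverse. *)
Lemma collapse_ext_eq b b0 (A : set b) (h : b -> b0) :
  compact [set: b] -> hausdorff_space b0 -> continuous h ->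
  (forall g, h (ext_emb b g) = ext_emb b0 g) ->
  (forall x y, h x = h y <-> x = y \/ A x /\ A y) ->
  ext_eq b0 (collapse_extension A).
Proof.
move=> cb hb0 hc he hA.
pose k : collapse_extension A -> b0 := fun q => h (collapse_repr q).
have kpi x : k (collapse_pi A x) = h x.
  apply/hA; apply/collapse_eqP; exact: collapse_reprK.
have kc : continuous k.
  apply: collapse_continuous; rewrite (_ : _ \o _ = h) //.
  by apply/funext => x; exact: kpi.
have kinj : injective k.
  move=> p q; rewrite -(collapse_reprK p) -(collapse_reprK q) !kpi => /hA.
  by move/collapse_eqP.
have kcpt : compact [set: collapse_extension A].
  rewrite (_ : setT = collapse_pi A @` setT).
    apply: continuous_compact => //; apply: continuous_subspaceT.
    exact: collapse_pi_continuous.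
  apply/seteqP; split=> // q _; exists (collapse_repr q) => //.
  exact: collapse_reprK.
have ke g : k (ext_emb (collapse_extension A) g) = ext_emb b0 g.
  by rewrite kpi he.
split; last by exists k.
have ksurj := ext_map_surj kcpt hb0 kc ke.
pose l q := projT1 (cid (ksurj q)); have lK : cancel l k.
  by move=> q; exact: projT2 (cid (ksurj q)).
exists l; first exact: closed_bijection_continuous kcpt hb0 kc lK kinj.
by move=> g; apply: kinj; rewrite lK ke.
Qed.

End DenseExtensions.

(** * Compactifications given as closures in an ambient space *)

Section ClosureExtensions.
Context {G : Type}.

Lemma set_type_cvg (Z : topologicalType) (A : set Z) (F : set_system A) (p : A) :
  Filter F -> \val @ F --> \val p -> F --> p.
Proof.
by move=> FF Fp U [/= _ [[W oW <-]] /= Wp /filterS]; apply; apply: Fp; exact: open_nbhs_nbhs.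
Qed.

Lemma set_type_val_continuous (Z : topologicalType) (A : set Z) :
  continuous (\val : A -> Z).
Proof. exact: (@initial_continuous A Z (\val : A -> Z)). Qed.

Lemma set_type_hausdorff (Z : topologicalType) (A : set Z) :
  hausdorff_space Z -> hausdorff_space A.
Proof.
move=> hZ p q pq; apply/val_inj/hZ => U V pU qV.
have [x [Ux Vx]] := pq _ _ (set_type_val_continuous pU) (set_type_val_continuous qV).
by exists (\val x).
Qed.

Lemma set_type_regular (Z : topologicalType) (A : set Z) :
  regular_space Z -> regular_space A.
Proof.
move=> rZ p U [/= _ [[W oW <-]] /= Wp WU].
have [|V pV VW] := rZ (\val p) W; first exact: open_nbhs_nbhs.
exists (\val @^-1` V); first exact: set_type_val_continuous.
move=> q qV; apply: WU; apply: VW => C qC.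
by have [x [Vx Cx]] := qV _ (set_type_val_continuous qC); exists (\val x).
Qed.

Lemma closure_ext_cvg (Z : topologicalType) (i : G -> Z) (F : set_system G) (z : Z) :
  ProperFilter F -> i @ F --> z ->
  exists2 p : closure_extension i, \val p = z & ext_emb (closure_extension i) @ F --> p.
Proof.
move=> FF Fz; have cz : closure (range i) z.
  move=> W zW; have [g Wg] := @filter_ex _ F _ (i @^-1` W) (Fz W zW).
  by exists (i g); split => //; exists g.
by exists (exist _ z (mem_set cz)) => //; exact: set_type_cvg.
Qed.

Lemma closure_ext_val_cvg (Z : topologicalType) (i : G -> Z) (F : set_system G)
    (p : closure_extension i) :
  Filter F -> ext_emb (closure_extension i) @ F --> p -> i @ F --> (\val p : Z).
Proof. by move=> FF Fp W pW; exact: (Fp _ (@set_type_val_continuous Z _ p W pW)). Qed.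

Lemma set_type_compact (Z : topologicalType) (A : set Z) :
  compact [set: Z] -> closed A -> compact [set: A].
Proof.
rewrite !compact_ultra => cZ cA F FU _.
have [z [_ Fz]] := cZ (\val @ F) (fmap_ultra _ FU) filterT.
have Az : A z.
  apply: cA => W zW; have [x Wx] := @filter_ex _ F _ (\val @^-1` W) (Fz W zW).
  by exists (\val x); split => //; exact: set_mem (valP x).
by exists (exist _ z (mem_set Az)); split => //; exact: set_type_cvg.
Qed.

(** A comparison induced by the ambient spaces is explicit on limit points, which the computation of
    its fibres requires. *)
Lemma closure_ext_map (Z Z' : topologicalType) (i : G -> Z) (i' : G -> Z')
    (f : Z -> Z') : continuous f -> (forall g, f (i g) = i' g) ->
  exists h : closure_extension i -> closure_extension i',
    [/\ continuous h,
        forall g, h (ext_emb (closure_extension i) g) =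
                  ext_emb (closure_extension i') g
      & forall p, \val (h p) = f (\val p)].
Proof.
move=> fc fi.
have hP (p : closure_extension i) : f (\val p) \in closure (range i').
  apply/mem_set => W /fc fW.
  have [_ [[g _ <-] Wg]] := set_mem (valP p) _ fW.
  by exists (i' g); split; [exists g|rewrite -fi].
exists (fun p => exist (fun z => z \in closure (range i')) _ (hP p)); split=> [p|g|//].
  apply: set_type_cvg => [|W pW]; first by apply: fmap_filter; exact: nbhs_filter.
  exact: (@set_type_val_continuous Z _ p _ (fc _ _ pW)).
by apply: val_inj; exact: fi.
Qed.

End ClosureExtensions.
(** * The Vietoris topology *)

Section HyperspaceTopology.
Context {Y : topologicalType}.
Implicit Types U V : set Y.

Lemma vietoris_subbase_open (i : bool * set Y) :
  open i.2 -> open (vietoris_subbase i).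
Proof.
move=> oi; exists [set vietoris_subbase i]; last by rewrite bigcup_set1.
by move=> _ ->; exact: (@finI_from1 _ _ [set i : bool * set Y | open i.2]).
Qed.

Lemma hyper_sub_open U : open U -> open [set H : hyperspace Y | H `<=` U].
Proof. by move=> oU; exact: (@vietoris_subbase_open (true, U)). Qed.

Lemma hyper_meet_open U : open U -> open [set H : hyperspace Y | H `&` U !=set0].
Proof. by move=> oU; exact: (@vietoris_subbase_open (false, U)). Qed.

Lemma hyper_cvg (F : set_system (hyperspace Y)) (L : hyperspace Y) : Filter F ->
  (forall U, open U -> L `<=` U -> F [set H : hyperspace Y | H `<=` U]) ->
  (forall U, open U -> L `&` U !=set0 -> F [set H : hyperspace Y | H `&` U !=set0]) ->
  F --> L.
Proof.
move=> FF Fs Fm W /= [_ [[B sB <-] [C BC CL]] BW].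
apply: filterS BW _; apply: (@filterS _ _ _ C); first by move=> H CH; exists C.
have [D sD DC] := sB _ BC; rewrite -DC; apply: filter_bigI => -[b U] DU.
have oU : open U by have := sD _ DU; rewrite inE.
have : vietoris_subbase (b, U) L by move: CL; rewrite -DC => /(_ _ DU).
by case: b {DU}; [exact: Fs|exact: Fm].
Qed.

Lemma hyper_eqP (H H' : hyperspace Y) : hyper_set H = hyper_set H' -> H = H'.
Proof.
case: H H' => [A Ac] [B Bc] /= AB; rewrite AB in Ac *.
by congr Hyperspace; exact: Prop_irrelevance.
Qed.

(** Off [L], regularity gives a neighbourhood of [y] whose closure misses [L], and sets close to [L]
    miss that closure. Thus the filter alone determines its limit. *)
Lemma hyper_limP (F : set_system (hyperspace Y)) (L : hyperspace Y) y :
  regular_space Y -> ProperFilter F -> F --> L ->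
  hyper_set L y <-> (forall U, open U -> U y -> F [set H : hyperspace Y | H `&` U !=set0]).
Proof.
move=> rY FF FL; split=> [Ly U oU Uy|h].
  apply: FL; apply: open_nbhs_nbhs; split; first exact: hyper_meet_open.
  by exists y.
apply: contrapT => nLy.
have [|V yV VL] := rY y (~` L).
  apply: open_nbhs_nbhs; split => //; apply: closed_openC; exact: hyper_closed.
have [O [oO Oy] OV] : exists2 O, open_nbhs y O & O `<=` V by rewrite nbhsE in yV.
have F1 : F [set H : hyperspace Y | H `<=` ~` closure V].
  apply: FL; apply: open_nbhs_nbhs; split.
    by apply: hyper_sub_open; apply: closed_openC; exact: closed_closure.
  by move=> z Lz /VL.
have [H [/= HV [z [Hz Oz]]]] := filter_ex (filterI F1 (h O oO Oy)).
by apply: (HV z Hz); apply: subset_closure; exact: OV.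
Qed.

Lemma hyper_hausdorff : regular_space Y -> hausdorff_space (hyperspace Y).
Proof.
move=> rY L M; rewrite cluster_cvgE => -[F FF [FM sF]].
have FL : F --> L by exact: sF.
apply: hyper_eqP; apply/seteqP; split=> y.
  by move/(hyper_limP y rY FF FL)/(hyper_limP y rY FF FM).
by move/(hyper_limP y rY FF FM)/(hyper_limP y rY FF FL).
Qed.

(** The limit of an ultrafilter consists of the [y] all of whose neighbourhoods meet almost every
    member. If almost every member left an open [U] containing this set, the points outside [U]
    would cluster at some [y] outside [U], and [y] would belong to the limit. *)
Lemma hyper_compact : compact [set: Y] -> compact [set: hyperspace Y].
Proof.
move=> cY; rewrite compact_ultra => F FU _.
pose L := [set y | forall U, open U -> U y -> F [set H : hyperspace Y | H `&` U !=set0]].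
have Lc : closed L.
  move=> y cy U oU Uy; have [z [Lz Uz]] := cy U (open_nbhs_nbhs (conj oU Uy)).
  exact: Lz.
exists (Hyperspace Lc); split => //; apply: hyper_cvg => U oU.
  move=> LU; apply: contrapT => nF.
  have FC : F [set H : hyperspace Y | H `&` ~` U !=set0].
    have [//|FnA] := in_ultra_setVsetC [set H : hyperspace Y | H `<=` U] FU.
    apply: filterS FnA => H /= /existsNP[y /not_implyP[Hy nUy]].
    by exists y.
  pose G := filter_from F
    (fun A => [set y | ~ U y /\ exists2 H : hyperspace Y, A H & hyper_set H y]).
  have GP : ProperFilter G.
    apply: filter_from_proper => [|A FA].
      apply: filter_from_filter; first by exists setT; exact: filterT.
      move=> A B FA FB; exists (A `&` B); first exact: filterI.
      by move=> y [nUy [H [AH BH] Hy]]; split; split=> //; exists H.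
    have [H [AH [y [Hy nUy]]]] := filter_ex (filterI FA FC).
    by exists y; split => //; exists H.
  have [y [_ cy]] := cY G GP filterT.
  have nUy : ~ U y.
    have : closed (~` U) by exact: open_closedC.
    apply=> W yW; apply: cy yW; exists setT; first exact: filterT.
    by move=> z [].
  apply/nUy/LU => V oV Vy.
  have [//|FnV] := in_ultra_setVsetC [set H : hyperspace Y | H `&` V !=set0] FU.
  pose A := ~` [set H : hyperspace Y | H `&` V !=set0].
  pose C := [set y | ~ U y /\ exists2 H, A H & hyper_set H y].
  have [|z [[_ [H nHV Hz]] Vz]] := cy C V _ (open_nbhs_nbhs (conj oV Vy)).
    by exists A.
  by case: nHV; exists z.
by move=> [y [Ly Uy]]; exact: Ly.
Qed.

End HyperspaceTopology.

Section HyperspaceImage.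
Context {Y Z : topologicalType} (f : Y -> Z).
Hypotheses (Yc : compact [set: Y]) (Zh : hausdorff_space Z) (fc : continuous f).

Lemma hyper_image_closed (H : hyperspace Y) : closed (f @` H).
Proof.
apply: compact_closed => //; apply: continuous_compact.
  exact: continuous_subspaceT.
exact: subclosed_compact (@hyper_closed _ H) Yc _.
Qed.

Definition hyper_image (H : hyperspace Y) : hyperspace Z :=
  Hyperspace (@hyper_image_closed H).

Lemma hyper_image_continuous : continuous hyper_image.
Proof.
have pre U : open U -> open (f @^-1` U).
  by move=> oU; exact: (iffLR (continuousP f)).
move=> H; apply: hyper_cvg => [|U oU HU|U oU [_ [[y Hy <-] Uy]]].
- by apply: fmap_filter; exact: nbhs_filter.
- apply: (@filterS _ (nbhs H) _ [set K : hyperspace Y | K `<=` f @^-1` U]).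
    by move=> K KU _ [y Ky <-]; exact: KU.
  apply: open_nbhs_nbhs; split; first exact/hyper_sub_open/pre.
  by move=> y Hy; apply: HU; exists y.
- apply: (@filterS _ (nbhs H) _ [set K : hyperspace Y | K `&` f @^-1` U !=set0]).
    by move=> K [z [Kz Uz]]; exists (f z); split=> //; exists z.
  apply: open_nbhs_nbhs; split; first exact/hyper_meet_open/pre.
  by exists y.
Qed.

End HyperspaceImage.

(** * Separation and compactness of products and of spaces of maps *)

Lemma compact_hausdorff_regular (Z : topologicalType) :
  hausdorff_space Z -> compact [set: Z] -> regular_space Z.
Proof. by move=> hZ cZ z; exact: (compact_regular hZ cZ filterT). Qed.

Lemma prod_hausdorff (S T : topologicalType) :
  hausdorff_space S -> hausdorff_space T -> hausdorff_space (S * T)%type.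
Proof.
move=> hS hT [s t] [s' t'] c; congr pair.
- apply: hS => U V sU s'V.
  have [||[a b] [[/= Ua _] [/= Va _]]] := c (U `*` setT) (V `*` setT).
  + by exists (U, setT) => //; split => //; exact: filterT.
  + by exists (V, setT) => //; split => //; exact: filterT.
  + by exists a.
- apply: hT => U V sU s'V.
  have [||[a b] [[/= _ Ua] [/= _ Va]]] := c (setT `*` U) (setT `*` V).
  + by exists (setT, U) => //; split => //; exact: filterT.
  + by exists (setT, V) => //; split => //; exact: filterT.
  + by exists b.
Qed.

Lemma prod_compact (S T : topologicalType) :
  compact [set: S] -> compact [set: T] -> compact [set: S * T].
Proof. by move=> cS cT; rewrite -setXTT; exact: compact_setX. Qed.

Lemma ptws_hausdorff (U : Type) (V : topologicalType) :
  hausdorff_space V -> hausdorff_space {ptws U -> V}.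
Proof.
move=> hV f g c; apply/funext => t; apply: hV => A B fA gB.
have [h [Ah Bh]] := c _ _ (ptws_eval_continuous fA) (ptws_eval_continuous gB).
by exists (h t).
Qed.

Lemma ptws_compact (U : Type) (V : topologicalType) :
  compact [set: V] -> compact [set: {ptws U -> V}].
Proof.
rewrite !compact_ultra => cV F FU _.
have ex t : exists v : V, (fun g : {ptws U -> V} => g t) @ F --> v.
  have FtU := fmap_ultra (fun g : {ptws U -> V} => g t) FU.
  by have [v [_ Fv]] := cV _ FtU filterT; exists v.
exists (fun t => projT1 (cid (ex t))); split => //.
by apply: ptws_cvg => t; exact: projT2 (cid (ex t)).
Qed.
(** * Ultrahomogeneous orders and their least compactification *)

Section Homogeneous.
Context {d : Order.disp_t} {X : orderTopologicalType d}.
Hypotheses (Xinf : infinite_set [set: X]) (Xhom : ultrahomogeneous X).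
Local Open Scope order_scope.
Implicit Types x y : X.

(** The form in which ultrahomogeneity is applied: the list may be unsorted with repetitions, and
    [f] is arbitrary outside it. *)
Lemma increasing_extension (P : seq X) (f : X -> X) :
  {in P &, {homo f : x y / x < y}} ->
  exists g : aut X, {in P, forall x, g x = f x}.
Proof.
move=> fP; set s := sort <=%O (undup P).
have sP x : (x \in s) = (x \in P) by rewrite mem_sort mem_undup.
have ss : sorted <%O s by rewrite sort_lt_sorted undup_uniq.
have sfs : sorted <%O (map f s).
  apply: (homo_sorted_in fP) ss.
  by apply/allP => x; rewrite sP.
have szf : size (map f s) == size s by rewrite size_map.
have [g gs] := @Xhom (size s) (in_tuple s) (Tuple szf) ss sfs.
exists g => x; rewrite -sP => xs.
have xi : (index x s < size s)%N by rewrite index_mem.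
have := gs (Ordinal xi).
by rewrite !(tnth_nth x) /= nth_index // (nth_map x) // nth_index.
Qed.

(** Moving the middle point of such a chain onto [x] shows that [X] has no end points; moving the
    outer ones onto [x < y] shows that it is dense. *)
Lemma three_points : exists a b c : X, a < b /\ b < c.
Proof.
have [B _ B3] := infinite_set_fset 3 Xinf.
have := sort_lt_sorted (finmap.enum_fset B); rewrite finmap.fset_uniq.
have := size_sort <=%O (finmap.enum_fset B).
case: (sort _ _) => [|a [|b [|c s]]] /= sz; rewrite -?sz // in B3.
by move=> /and3P[ab bc _]; exists a, b, c.
Qed.

Lemma lt_ex x : exists y, y < x.
Proof.
have [a [b [c [ab bc]]]] := three_points.
have [|g gP] := @increasing_extension [:: b] (fun=> x).
  by move=> u v; rewrite !inE => /eqP-> /eqP->; rewrite ltxx.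
exists (g a); rewrite -(gP b) ?inE //; by rewrite aut_lt.
Qed.

Lemma gt_ex x : exists y, x < y.
Proof.
have [a [b [c [ab bc]]]] := three_points.
have [|g gP] := @increasing_extension [:: b] (fun=> x).
  by move=> u v; rewrite !inE => /eqP-> /eqP->; rewrite ltxx.
exists (g c); rewrite -(gP b) ?inE //; by rewrite aut_lt.
Qed.

Lemma between_ex x y : x < y -> exists z, x < z /\ z < y.
Proof.
have [a [b [c [ab bc]]]] := three_points => xy.
have ac := lt_trans ab bc.
have [|g gP] := @increasing_extension [:: a; c] (fun u => if u == a then x else y).
  move=> u v; rewrite !inE => /orP[]/eqP-> /orP[]/eqP->; rewrite ?ltxx ?eqxx //.
    by rewrite (gt_eqF ac).
  by rewrite ltNge ltW.
exists (g b); split.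
  have <- : g a = x by rewrite gP ?inE eqxx.
  by rewrite aut_lt.
have <- : g c = y by rewrite gP ?inE ?eqxx ?orbT // (gt_eqF ac).
by rewrite aut_lt.
Qed.

Lemma seq_max (s : seq X) : s != [::] -> exists2 m, m \in s & {in s, forall x, x <= m}.
Proof.
elim: s => // a [|b s] IH _.
  by exists a; rewrite ?mem_seq1 // => x; rewrite inE => /eqP->.
have [//|m ms mP] := IH; have [am|ma] := leP a m.
  exists m; first by rewrite inE ms orbT.
  by move=> x; rewrite inE => /orP[/eqP->//|/mP].
exists a; first by rewrite inE eqxx.
move=> x; rewrite inE => /orP[/eqP->//|/mP xm].
exact: le_trans (ltW ma).
Qed.

Lemma seq_min (s : seq X) : s != [::] -> exists2 m, m \in s & {in s, forall x, m <= x}.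
Proof.
elim: s => // a [|b s] IH _.
  by exists a; rewrite ?mem_seq1 // => x; rewrite inE => /eqP->.
have [//|m ms mP] := IH; have [ma|am] := leP m a.
  exists m; first by rewrite inE ms orbT.
  by move=> x; rewrite inE => /orP[/eqP->//|/mP].
exists a; first by rewrite inE eqxx.
move=> x; rewrite inE => /orP[/eqP->//|/mP xm].
exact: le_trans (ltW am) _.
Qed.

(** Density for finitely many constraints; the absence of end points covers an empty list. *)
Lemma seq_separation (A B : seq X) : {in A & B, forall a b, a < b} ->
  exists u, {in A, forall a, a < u} /\ {in B, forall b, u < b}.
Proof.
move=> AB; have [A0|/seq_max[m mA mP]] := eqVneq A [::].
  subst A; have [B0|/seq_min[m mB mP]] := eqVneq B [::].
    by subst B; have [a _] := three_points; exists a.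
  have [u um] := lt_ex m; exists u; split=> // b /mP.
  exact: lt_le_trans.
have [B0|/seq_min[k kB kP]] := eqVneq B [::].
  subst B; have [u um] := gt_ex m; exists u; split=> // b /mP bm.
  exact: le_lt_trans um.
have [u [mu uk]] := between_ex (AB _ _ mA kB).
exists u; split=> [a /mP am|b /kP]; first exact: le_lt_trans mu.
exact: lt_le_trans.
Qed.

Definition cm_pt x : cm X := Cm (or_introl (ex_intro _ x erefl)).

Lemma cm_pt_leE x (s : cm X) : (cm_pt x <= s) = `[< cm_set s x >].
Proof.
apply/idP/idP => /asboolP h; apply/asboolP; first exact: h (lexx x).
by move=> y yx; exact: cm_lower h.
Qed.

Lemma lt_cm_ptE x (s : cm X) : (s < cm_pt x) = ~~ `[< cm_set s x >].
Proof. by rewrite ltNge cm_pt_leE. Qed.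

Lemma cm_pt_le : {mono cm_pt : x y / x <= y}.
Proof. by move=> x y; rewrite cm_pt_leE /= asboolb. Qed.

Lemma cm_pt_lt : {mono cm_pt : x y / x < y}.
Proof. exact: leW_mono cm_pt_le. Qed.

Lemma cm_act_pt (g : aut X) x : cm_act g (cm_pt x) = cm_pt (g x).
Proof.
apply: cm_eqP => /=; apply/seteqP; split=> [_ [y /= yx <-]|y /= ygx].
  by rewrite /= aut_le.
exists (g^-1%g y); last by rewrite /= autVK.
by rewrite /= -(aut_le g) /= autVK.
Qed.

(** An element [y] of [t] outside [s] gives only [cm_pt y <= t]. A smaller element outside [s] makes
    this strict: it exists by density when [s] is a point, and by the definition of a gap
    otherwise. *)
Lemma cm_lt_pt (s t : cm X) : s < t -> exists x, s < cm_pt x /\ cm_pt x < t.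
Proof.
rewrite ltNge cm_leE => /asboolPn/existsNP[y /not_implyP[ty sy]].
suff [z zy sz] : exists2 z, z < y & ~ cm_set s z.
  exists z; split; first by rewrite lt_cm_ptE; apply/asboolPn.
  apply: (@lt_le_trans _ _ (cm_pt y)); first by rewrite cm_pt_lt.
  by rewrite cm_pt_leE; apply/asboolP.
case: s sy => S [[x /= ->]|[_ _ nmin]] /= sy.
  have [|z [xz zy]] := @between_ex x y; first by rewrite ltNge; apply/negP.
  by exists z => //; apply/negP; rewrite -ltNge.
by have [z Sz zy] := nmin y sy; exists z.
Qed.

Lemma cm_between (s t : cm X) : s < t -> exists u : cm X, s < u /\ u < t.
Proof. by move/cm_lt_pt => [x h]; exists (cm_pt x). Qed.

Lemma cm_bot_lt_pt x : \bot < cm_pt x.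
Proof.
have [y yx] := lt_ex x; apply: (@le_lt_trans _ _ (cm_pt y)); last by rewrite cm_pt_lt.
exact: le0x.
Qed.

Lemma cm_pt_lt_top x : cm_pt x < \top.
Proof.
have [y yx] := gt_ex x; apply: (@lt_le_trans _ _ (cm_pt y)); first by rewrite cm_pt_lt.
exact: lex1.
Qed.

Lemma cm_bot_lt_top : (\bot : cm X) < \top.
Proof.
have [a _] := three_points; exact: lt_trans (cm_bot_lt_pt a) (cm_pt_lt_top a).
Qed.

(** The union [L] of the lower parts is downward closed. If [L] has a greatest element or its
    complement a least one, that point is the supremum; otherwise [L] is itself a gap. *)
Lemma cm_sup (E : set (cm X)) : exists s : cm X,
  (forall t, E t -> t <= s) /\ (forall u, (forall t, E t -> t <= u) -> s <= u).
Proof.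
pose L := \bigcup_(t in E) cm_set t.
have Llow x y : x <= y -> L y -> L x.
  by move=> xy [t Et ty]; exists t => //; exact: cm_lower ty.
have Lsub (s : cm X) : (forall u : cm X, L `<=` cm_set u -> s <= u) ->
    L `<=` cm_set s -> exists s : cm X,
    (forall t, E t -> t <= s) /\ (forall u, (forall t, E t -> t <= u) -> s <= u).
  move=> h Ls; exists s; split=> [t Et|u uE].
    by apply/asboolP => x tx; apply: Ls; exists t.
  by apply: h => x [t Et tx]; have /asboolP := uE t Et; apply.
have [[m Lm mP]|nmax] := pselect (exists2 m, L m & forall x, L x -> x <= m).
  apply: (Lsub (cm_pt m)) => [u /(_ m Lm) um|x /mP//].
  by rewrite cm_pt_leE; apply/asboolP.
have [[m nLm mP]|nmin] := pselect (exists2 m, ~ L m & forall x, ~ L x -> m <= x).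
  have lm x : L x -> x < m.
    by move=> Lx; rewrite ltNge; apply/negP => mx; apply: nLm; exact: Llow Lx.
  apply: (Lsub (cm_pt m)) => [u Lu|x /lm/ltW//].
  rewrite leNgt; apply/negP => /cm_lt_pt[x [ux]]; rewrite cm_pt_lt => xm.
  have : L x by apply: contrapT => /mP; rewrite leNgt xm.
  by move/Lu => h; move: ux; rewrite lt_cm_ptE => /asboolPn; apply.
have Lgap : gap L.
  split=> [//|x Lx|x nLx]; apply: contrapT => h.
    apply: nmax; exists x => // y Ly; rewrite leNgt; apply/negP => xy.
    by apply: h; exists y.
  apply: nmin; exists x => // y nLy; rewrite leNgt; apply/negP => yx.
  by apply: h; exists y.
by apply: (Lsub (Cm (or_intror Lgap))) => // u Lu; apply/asboolP.
Qed.

(** An ultrafilter converges to the supremum of the [t] that lie below almost every point. *)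
Lemma cm_compact : compact [set: cm X].
Proof.
rewrite compact_ultra => F FU _.
have [s [sub lub]] := cm_sup [set t | F [set u | t <= u]].
exists s; split => //; apply: order_cvg => [a as_|b sb].
  apply: contrapT => nF; move: as_; rewrite ltNge => /negP; apply.
  apply: lub => t Ft; rewrite leNgt; apply/negP => at_; apply: nF.
  by apply: filterS Ft => u /=; exact: lt_le_trans.
have [Fb|] := in_ultra_setVsetC [set u | b <= u] FU.
  by move: (sub _ Fb); rewrite leNgt sb.
by apply: filterS => u /= /negP; rewrite -ltNge.
Qed.

(** Closed intervals treat the ends uniformly: a bound not strictly on its side of [s] is [\bot] or
    [\top], which every automorphism fixes. *)
Lemma cm_nbhs_itv (s : cm X) (W : set (cm X)) : nbhs s W ->
  exists u v : cm X, [/\ u <= s <= v, u = \bot \/ u < s, v = \top \/ s < v &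
    forall t, u <= t <= v -> W t].
Proof.
rewrite itv_nbhsE => -[[l r] [oi]]; rewrite itv_boundlr => /andP[ls sr] iW.
have [ol or] : l <> BLeft (if l is BSide _ x then x else s) /\
    r <> BRight (if r is BSide _ x then x else s).
  by case: l r oi {ls sr iW} => [[] l|[]] [[] r|[]].
have [u [us ub uW]] : exists u : cm X, [/\ u <= s, u = \bot \/ u < s &
    forall t, u <= t -> (l <= BLeft t)%O].
  case: l ol ls {oi iW} => [[] l|[]] //= _.
  - rewrite bnd_simp => /cm_between[u [lu us]].
    exists u; split; [exact: ltW|by right|].
    by move=> t ut; rewrite bnd_simp; exact: lt_le_trans ut.
  - by exists \bot; split; [exact: le0x|left|].
have [v [vs vb vW]] : exists v : cm X, [/\ s <= v, v = \top \/ s < v &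
    forall t, t <= v -> (BRight t <= r)%O].
  case: r or sr {oi iW} => [[] r|[]] //= _.
  - rewrite bnd_simp => /cm_between[v [sv vr]].
    exists v; split; [exact: ltW|by right|].
    by move=> t tv; rewrite bnd_simp; exact: le_lt_trans tv vr.
  - by exists \top; split; [exact: lex1|left|].
exists u, v; split=> // [|t /andP[ut tv]]; first by rewrite us.
by apply: iW; rewrite /= itv_boundlr uW // vW.
Qed.

End Homogeneous.
(** * The Ellis semigroup *)

Section Ellis.
Context {d : Order.disp_t} {X : orderTopologicalType d}.
Hypotheses (Xinf : infinite_set [set: X]) (Xhom : ultrahomogeneous X).
Local Open Scope order_scope.
Implicit Types (s t u : cm X) (f h : cm X -> cm X).

Definition end_monotone f :=
  [/\ {homo f : s t / s <= t}, f \bot = \bot & f \top = \top].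

Definition cut_map f := end_monotone f /\ forall t, f t = \bot \/ f t = \top.

Local Notation ellis := (closure (range (ellis_map (@cm_act d X)))).

Lemma nbhs_ptws_gt (f : {ptws cm X -> cm X}) t u :
  u < f t -> nbhs f [set h : {ptws cm X -> cm X} | u < h t].
Proof. by move=> h; exact: (ptws_eval_continuous (near_gt h)). Qed.

Lemma nbhs_ptws_lt (f : {ptws cm X -> cm X}) t u :
  f t < u -> nbhs f [set h : {ptws cm X -> cm X} | h t < u].
Proof. by move=> h; exact: (ptws_eval_continuous (near_lt h)). Qed.

(** Each violation is an open condition on at most two values, so it would be shared by an
    automorphism. *)
Lemma ellis_end_monotone (f : {ptws cm X -> cm X}) : ellis f -> end_monotone f.
Proof.
move=> Sf; split=> [s t st||].
- rewrite leNgt; apply/negP => /(cm_between Xinf Xhom)[c [tc cs]].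
  have [_ [[g _ <-] [/= gs gt]]] :=
    Sf _ (filterI (nbhs_ptws_gt cs) (nbhs_ptws_lt tc)).
  have := lt_trans gt gs; rewrite /ellis_map cm_act_lt => /lt_geF.
  by rewrite st.
- apply/eqP; rewrite eq_le le0x andbT leNgt; apply/negP => h.
  have [_ [[g _ <-] /=]] := Sf _ (nbhs_ptws_gt h).
  by rewrite /ellis_map cm_act_bot ltxx.
- apply/eqP; rewrite eq_le lex1 /= leNgt; apply/negP => h.
  have [_ [[g _ <-] /=]] := Sf _ (nbhs_ptws_lt h).
  by rewrite /ellis_map cm_act_top ltxx.
Qed.

Lemma closure_image_sub (T U : topologicalType) (k : T -> U) (A : set T)
    (B : set U) : continuous k -> A `<=` k @^-1` B -> closed B ->
  closure A `<=` k @^-1` B.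
Proof.
move=> kc AB Bc x Ax; apply: Bc => W /kc/Ax[y [Ay Wy]].
by exists (k y); split=> //; exact: AB.
Qed.

(** Composition is continuous in its left factor, and in its right factor when the left one is
    continuous. So the case of an automorphism on the left is settled before the left factor is
    allowed to vary in the closure. *)
Lemma ellis_comp (f h : {ptws cm X -> cm X}) :
  ellis f -> ellis h -> ellis (f \o h).
Proof.
have ptws_comp (k : {ptws cm X -> cm X} -> {ptws cm X -> cm X}) :
    (forall t, continuous (fun l => k l t)) -> continuous k.
  move=> kc l; apply: ptws_cvg => [|t]; last exact: kc.
  by apply: fmap_filter; exact: nbhs_filter.
have Scl : closed ellis by exact: closed_closure.
move=> Sf Sh.
have Sg (g : aut X) : ellis (cm_act g \o h).
  apply: (@closure_image_sub _ _
    (fun l : {ptws cm X -> cm X} => cm_act g \o l : {ptws cm X -> cm X}) _ _ _ _ Scl h Sh).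
    apply: ptws_comp => t l W hW.
    exact: (@ptws_eval_continuous _ _ t l _ (cm_act_continuous hW)).
  move=> _ [k _ <-]; apply: subset_closure; exists (g * k)%g => //.
  apply/funext => t; apply: cm_eqP.
  by rewrite /ellis_map /= image_comp.
apply: (@closure_image_sub _ _
  (fun l : {ptws cm X -> cm X} => l \o h : {ptws cm X -> cm X}) _ _ _ _ Scl f Sf).
  by apply: ptws_comp => t; exact: (@ptws_eval_continuous _ _ (h t)).
by move=> _ [g _ <-]; exact: Sg.
Qed.

Section CutFilter.
Variable f : cm X -> cm X.
Hypothesis f_cut : cut_map f.

(** One pair [a], [b] per basic set suffices: by monotonicity, finitely many points of each level
    set are controlled by the greatest with value [\bot] and the least with value [\top]. *)
Definition cut_filter : set_system (aut X) :=
  filter_from [set p : (cm X * cm X) * (X * X) | f p.1.1 = \bot /\ f p.1.2 = \top]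
    (fun p => [set g : aut X | cm_act g p.1.1 < cm_pt p.2.1 /\
                               cm_pt p.2.2 < cm_act g p.1.2]).

Lemma cut_filter_proper : ProperFilter cut_filter.
Proof.
have [[fmono f0 f1] _] := f_cut.
apply: filter_from_proper => [|[[a b] [u v]] [/= fa fb]].
  apply: filter_from_filter.
    have [x _] := three_points Xinf.
    by exists ((\bot, \top), (x, x)).
  move=> [[a b] [u v]] [[a' b'] [u' v']] [/= fa fb] [/= fa' fb'].
  exists ((Order.max a a', Order.min b b'), (Order.min u u', Order.max v v')) => /=.
    by case: leP => _; case: leP => _.
  move=> g /= [au vb]; split; split.
  - apply: le_lt_trans (lt_le_trans au _); first by rewrite cm_act_le le_max lexx.
    by rewrite cm_pt_le ge_min lexx.
  - apply: lt_le_trans (le_lt_trans _ vb) _; last by rewrite cm_act_le ge_min lexx.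
    by rewrite cm_pt_le le_max lexx.
  - apply: le_lt_trans (lt_le_trans au _); first by rewrite cm_act_le le_max lexx orbT.
    by rewrite cm_pt_le ge_min lexx orbT.
  - apply: lt_le_trans (le_lt_trans _ vb) _; last by rewrite cm_act_le ge_min lexx orbT.
    by rewrite cm_pt_le le_max lexx orbT.
have ab : a < b.
  rewrite ltNge; apply/negP => /fmono; rewrite fa fb leNgt.
  by rewrite (cm_bot_lt_top Xinf Xhom).
have [x [ax xb]] := cm_lt_pt Xinf Xhom ab.
have [y [xy yb]] := cm_lt_pt Xinf Xhom xb; rewrite cm_pt_lt in xy.
(* Nothing relates [u] and [v]; going below both and above both ensures [p < q]. *)
have [p pm] := lt_ex Xinf Xhom (Order.min u v).
have [q qm] := gt_ex Xinf Xhom (Order.max u v).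
move: pm qm; rewrite lt_min gt_max => /andP[pu pv] /andP[uq vq].
have [|g gP] := @increasing_extension _ _ Xhom [:: x; y] (fun z => if z == x then p else q).
  move=> z w; rewrite !inE => /orP[]/eqP-> /orP[]/eqP->; rewrite ?ltxx ?eqxx //.
    by move=> _; rewrite (gt_eqF xy); exact: lt_trans uq.
  by rewrite ltNge ltW.
exists g; split => /=.
  apply: (@lt_trans _ _ (cm_act g (cm_pt x))); first by rewrite cm_act_lt.
  by rewrite cm_act_pt cm_pt_lt gP ?inE ?eqxx.
apply: (@lt_trans _ _ (cm_act g (cm_pt y))); last by rewrite cm_act_lt.
by rewrite cm_act_pt cm_pt_lt gP ?inE ?eqxx ?orbT // (gt_eqF xy).
Qed.

Lemma cut_filter_cvg t : (fun g : aut X => cm_act g t) @ cut_filter --> f t.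
Proof.
have [[fmono f0 f1] f01] := f_cut.
have FF := cut_filter_proper.
have [x _] := three_points Xinf.
have [ft|ft] := f01 t; rewrite ft; apply: order_cvg => [a a0|b b0].
- by move: a0; rewrite ltNge le0x.
- have [u [_ ub]] := cm_lt_pt Xinf Xhom b0.
  exists ((t, \top), (u, x)) => //= g [/= tu _].
  exact: lt_trans tu ub.
- have [u [au _]] := cm_lt_pt Xinf Xhom a0.
  exists ((\bot, t), (x, u)) => //= g [/= _ tu].
  exact: lt_trans au tu.
- by move: b0; rewrite ltNge lex1.
Qed.

Lemma cut_map_ellis : ellis f.
Proof.
have FF := cut_filter_proper.
have Ff : (ellis_map (@cm_act d X)) @ cut_filter --> (f : {ptws cm X -> cm X}).
  by apply: ptws_cvg => t; exact: cut_filter_cvg.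
move=> W fW; have [g Wg] := @filter_ex _ cut_filter _ _ (Ff W fW).
by exists (ellis_map (@cm_act d X) g); split => //; exists g.
Qed.

End CutFilter.

Lemma f_minus_cut y : y != \top -> cut_map (f_minus y).
Proof.
move=> yT; rewrite /cut_map /end_monotone /f_minus; split=> [|t]; last first.
  by case: ifP; [left|right].
split=> [s t st||]; last 2 first.
- by rewrite le0x.
- by rewrite le1x (negbTE yT).
case: ifP => [|sy]; first by rewrite le0x.
by case: ifP => // ty; rewrite (le_trans st ty) in sy.
Qed.

Lemma f_plus_cut z : z != \bot -> cut_map (f_plus z).
Proof.
move=> z0; rewrite /cut_map /end_monotone /f_plus; split=> [|t]; last first.
  by case: ifP; [left|right].
split=> [s t st||]; last 2 first.
- by rewrite lt0x z0.
- by rewrite ltNge lex1.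
case: ifP => [|sz]; first by rewrite le0x.
by case: ifP => // tz; rewrite (le_lt_trans st tz) in sz.
Qed.

(** The jump is at the supremum [y] of the level set of [\bot]; the value at [y] decides between
    [f_minus] and [f_plus]. *)
Lemma I_mapsP f : I_maps X f <-> cut_map f.
Proof.
split=> [[[y /= yT <-]|[z /= z0 <-]]|[[fmono f0 f1] f01]].
- exact: f_minus_cut.
- exact: f_plus_cut.
have bt := cm_bot_lt_top Xinf Xhom.
have [y [sub lub]] := cm_sup Xinf Xhom [set t | f t = \bot].
have above t : y < t -> f t = \top.
  by move=> yt; have [/sub|//] := f01 t; rewrite leNgt yt.
have [fy|fy] := f01 y; [left|right].
  exists y.
    by apply/eqP => yT; move: bt; rewrite -fy yT f1 ltxx.
  apply/funext => t; rewrite /f_minus; case: leP => [ty|/above//].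
  by apply/eqP; rewrite eq_sym -lex0 -fy; exact: fmono.
exists y.
  by apply/eqP => y0; move: bt; rewrite -fy y0 f0 ltxx.
apply/funext => t; rewrite /f_plus; case: ltP => [ty|yt]; last first.
  by apply/eqP; rewrite eq_sym -le1x -fy; exact: fmono.
have [//|ft] := f01 t; move: ty; rewrite ltNge => /negP[].
apply: lub => s fs; rewrite leNgt; apply/negP => /ltW/fmono.
by rewrite ft fs leNgt bt.
Qed.

(** Within the Ellis semigroup, [I] is singled out by having only the values [\bot] and [\top]. This
    is a closed condition, and it survives composition on both sides because every limit map fixes
    the two ends. *)
Lemma I_maps_closed_ideal : closed_ideal ellis (I_maps X).
Proof.
have IS : I_maps X `<=` ellis by move=> f /I_mapsP; exact: cut_map_ellis.
have IP f : ellis f -> (forall t, f t = \bot \/ f t = \top) -> I_maps X f.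
  by move=> /ellis_end_monotone fm f01; apply/I_mapsP.
split=> //.
- exact: ellis_comp.
- exists (f_plus \top); right; exists \top => //=.
  by rewrite gt_eqF // cm_bot_lt_top.
- move=> f cf; have Sf : ellis f.
    by apply: (@closed_closure _ (range (ellis_map (@cm_act d X)))); exact: closureS cf.
  apply: IP => // t; apply: contrapT => /not_orP[/eqP f0 /eqP f1].
  have f0' : \bot < f t by rewrite lt0x.
  have f1' : f t < \top by rewrite ltx1.
  have [h [/I_mapsP[_ h01] [/= h0 h1]]] :=
    cf _ (filterI (nbhs_ptws_gt f0') (nbhs_ptws_lt f1')).
  by have [ht|ht] := h01 t; move: h0 h1; rewrite ht ltxx.
- move=> f h Sf /[dup] Ih /I_mapsP[_ h01]; have Sh := IS _ Ih.
  have [_ f0 f1] := ellis_end_monotone Sf.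
  split; (apply: IP => [|t /=]; first exact: ellis_comp); last exact: h01.
  by have [->|->] := h01 t; rewrite ?f0 ?f1; [left|right].
Qed.

End Ellis.
(** * Completed graphs *)

Section CompletedGraph.
Context {d : Order.disp_t} {X : orderTopologicalType d}.
Hypotheses (Xinf : infinite_set [set: X]) (Xhom : ultrahomogeneous X).
Local Open Scope order_scope.
Implicit Types (s t u : cm X) (f : cm X -> cm X).

(* The graph of a monotone map, with its jumps filled in by vertical segments. *)
Definition completed_graph f : set (cm X * cm X) :=
  [set p | (forall u, u < p.1 -> f u <= p.2) /\ (forall u, p.1 < u -> p.2 <= f u)].

Lemma completed_graph_self f s :
  {homo f : s t / s <= t} -> completed_graph f (s, f s).
Proof. by move=> fm; split=> u /= /ltW; exact: fm. Qed.

(** Filling the jumps makes every height occur, namely at the supremum of the arguments where [f] is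
    at most [t]. *)
Lemma completed_graph_level f t :
  {homo f : s t / s <= t} -> exists s, completed_graph f (s, t).
Proof.
move=> fm; have [s [sub lub]] := cm_sup Xinf Xhom [set s | f s <= t].
exists s; split=> u /= us.
  rewrite leNgt; apply/negP => tu; move: us; rewrite ltNge => /negP; apply.
  apply: lub => v fv; rewrite leNgt; apply/negP => /ltW/fm uv.
  by move: (le_trans uv fv); rewrite leNgt tu.
rewrite ltW // ltNge; apply/negP => /sub; by rewrite leNgt us.
Qed.

(** A monotone graph crosses a rectangle as soon as it is not above it at its left side nor below it
    at its right side, and the pointwise limit ensures both. Conversely, a failed inequality at [u]
    yields an open quadrant around the point which the graph of a nearby [g] cannot enter. *)
Lemma limit_completed_graph (F : set_system (aut X)) f : ProperFilter F ->
  (forall t, (fun g => cm_act g t) @ F --> f t) ->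
  forall p, completed_graph f p <->
    (forall U, open U -> U p -> F [set g | graph (cm_act g) `&` U !=set0]).
Proof.
move=> FF Ff [s t].
have Fgt u c : c < f u -> F [set g | c < cm_act g u] by move/near_gt/Ff.
have Flt u c : f u < c -> F [set g | cm_act g u < c] by move/near_lt/Ff.
split=> [[/= below above] U oU Ust|h].
  have /= [[I J] [/= sI tJ] IJ] : nbhs (s, t) U by exact: open_nbhs_nbhs.
  have [x1 [x2 [/andP[x1s sx2] x1b x2b xI]]] := cm_nbhs_itv Xinf Xhom sI.
  have [y1 [y2 [/andP[y1t ty2] y1b y2b yJ]]] := cm_nbhs_itv Xinf Xhom tJ.
  have F1 : F [set g | cm_act g x1 <= y2].
    case: x1b => [->|x1s'].
      by apply: filterE => g /=; rewrite cm_act_bot le0x.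
    case: y2b => [->|ty2']; first by apply: filterE => g /=; rewrite lex1.
    have := Flt x1 y2 (le_lt_trans (below _ x1s') ty2').
    by apply: filterS => g /= /ltW.
  have F2 : F [set g | y1 <= cm_act g x2].
    case: x2b => [->|sx2'].
      by apply: filterE => g /=; rewrite cm_act_top lex1.
    case: y1b => [->|y1t']; first by apply: filterE => g /=; rewrite le0x.
    have := Fgt x2 y1 (lt_le_trans y1t' (above _ sx2')).
    by apply: filterS => g /= /ltW.
  apply: filterS (filterI F1 F2) => g [/= g1 g2].
  (* This height is in [[y1, y2]] and in [[g x1, g x2]], so the graph passes through the rectangle
     at height [r]. *)
  pose r := Order.max (cm_act g x1) y1.
  exists (cm_act g^-1%g r, r); split; first by rewrite /graph /= cm_actVK.
  apply: IJ; split => /=.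
    apply: xI; rewrite -(cm_act_le g) cm_actVK le_max lexx /=.
    by rewrite -(cm_act_le g _ x2) cm_actVK ge_max g2 andbT cm_act_le (le_trans x1s).
  by apply: yJ; rewrite le_max lexx orbT ge_max g1 (le_trans y1t).
have rayU c : open [set u : cm X | c < u].
  by have := @rray_open _ (cm X) c; rewrite set_itvE.
have rayL c : open [set u : cm X | u < c].
  by have := @lray_open _ (cm X) c; rewrite set_itvE.
have prodO (A B : set (cm X)) : open A -> open B -> open (A `*` B).
  move=> oA oB; rewrite openE => -[a b] [/= Aa Bb].
  by exists (A, B) => //; split; exact: open_nbhs_nbhs.
split=> u /= us; rewrite leNgt; apply/negP => /(cm_between Xinf Xhom)[c [tc cf]].
  have F1 := h _ (prodO _ _ (rayU u) (rayL c)) (conj us tc).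
  have [g [[[r q] [gr [/= ur rc]]] /= cg]] := filter_ex (filterI F1 (Fgt _ _ cf)).
  rewrite /graph /= in gr; subst q.
  by have := lt_trans rc cg; rewrite cm_act_lt => /(lt_trans ur); rewrite ltxx.
have F1 := h _ (prodO _ _ (rayL u) (rayU c)) (conj us cf).
have [g [[[r q] [gr [/= ur rc]]] /= cg]] := filter_ex (filterI F1 (Flt _ _ tc)).
rewrite /graph /= in gr; subst q.
by have := lt_trans cg rc; rewrite cm_act_lt => /lt_trans/(_ ur); rewrite ltxx.
Qed.

Lemma completed_graph_f_plus_top : completed_graph (f_plus \top) = graph_A X.
Proof.
apply/seteqP; split=> [[s t] /= [below above]|[s t] /= [[_ /= ->]|[/= -> _]]].
- have [s1|] := eqVneq s \top; first by right.
  rewrite -ltx1 => /(cm_between Xinf Xhom)[u [su u1]]; left; split => //=.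
  by apply/eqP; rewrite -lex0; move: (above u su); rewrite /f_plus u1.
- split=> u /= us; last exact: le0x.
  by rewrite /f_plus (lt_le_trans us (lex1 _)).
- split=> u /=; last by rewrite ltNge lex1.
  by rewrite /f_plus => ->; exact: le0x.
Qed.

Lemma completed_graph_f_minus_bot : completed_graph (f_minus \bot) = graph_B X.
Proof.
apply/seteqP; split=> [[s t] /= [below above]|[s t] /= [[/= -> _]|[_ /= ->]]].
- have [s0|] := eqVneq s \bot; first by left.
  rewrite -lt0x => /(cm_between Xinf Xhom)[u [u0 us]]; right; split => //=.
  by apply/eqP; rewrite -le1x; move: (below u us); rewrite /f_minus (lt_geF u0).
- split=> u /=; first by rewrite ltNge le0x.
  by rewrite /f_minus => /lt_geF->; exact: lex1.
- split=> u /= us; first exact: lex1.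
  by rewrite /f_minus (lt_geF (le_lt_trans (le0x _) us)).
Qed.

(** Equality of the images in [cX]. *)
Definition end_equiv s t := s = t \/ [set \bot; \top : cm X] s /\ [set \bot; \top] t.

(** Inclusion of the images in the square of [cX], expressed before collapsing. *)
Definition end_sub (A B : set (cm X * cm X)) := forall s t, A (s, t) ->
  exists s' t', [/\ B (s', t'), end_equiv s s' & end_equiv t t'].

Lemma end_equiv_between s t s' : s < t -> t < s' -> forall t', end_equiv t t' -> t' = t.
Proof.
move=> st ts' t' [//|[[t0|t1] _]].
- by move: st; rewrite t0 ltNge le0x.
- by move: ts'; rewrite t1 ltNge lex1.
Qed.

(* If [f] lies below [f'] over an interval, equality of the collapsed graphs
   forces both graphs onto the boundary of the square. *)
Lemma crossing_end_sub f f' x y : end_monotone f -> end_monotone f' ->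
  end_sub (completed_graph f) (completed_graph f') ->
  end_sub (completed_graph f') (completed_graph f) ->
  x < y -> f y < f' x -> f = f_plus \top /\ f' = f_minus \bot.
Proof.
move=> [fm f0 f1] [fm' f0' f1'] sub sub' xy fyx.
(* The argument [z] is not an end, so the matching point of the graph of [f] is also over [z], but
   at a height at most [f y < f' z]. Different heights are identified only when they are the two
   ends. *)
have main z : x < z -> z < y -> f' z = \top /\ completed_graph f (z, \bot).
  move=> xz zy.
  have [s' [t' [ft' /(end_equiv_between xz zy) zs te]]] :=
    sub' z (f' z) (completed_graph_self z fm'); subst s'.
  have t'lt : t' < f' z.
    apply: (@le_lt_trans _ _ (f y)); first exact: ft'.2.
    exact: lt_le_trans fyx (fm' _ _ (ltW xz)).
  case: te => [t'E|[[fz|fz] [t'E|t'E]]].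
  - by move: t'lt; rewrite t'E ltxx.
  - by move: t'lt; rewrite fz ltNge le0x.
  - by move: t'lt; rewrite fz ltNge le0x.
  - by rewrite fz -t'E.
  - by move: t'lt; rewrite t'E ltNge lex1.
have fbot u : u < y -> f u = \bot.
  move=> uy.
  have [z [xz zy]] : exists z, x < z /\ z < y /\ u < z.
    have : Order.max x u < y by rewrite gt_max xy.
    move=> /(cm_between Xinf Xhom)[z [+ zy]]; rewrite gt_max => /andP[xz uz].
    by exists z.
  have [_ [/= below _]] := main z xz zy.1.
  by apply/eqP; rewrite -lex0; exact: below zy.2.
have ftop u : x < u -> f' u = \top.
  move=> xu; have : x < Order.min y u by rewrite lt_min xy.
  move=> /(cm_between Xinf Xhom)[z [xz]]; rewrite lt_min => /andP[zy zu].
  have [fz _] := main z xz zy.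
  by apply/eqP; rewrite -le1x -fz; exact/fm'/ltW.
split; apply/funext => w.
- rewrite /f_plus; case: ltP => [w1|]; last first.
    by rewrite le1x => /eqP->.
  (* A height [t] strictly between the ends would occur on the graph of [f] over some [s] in
     [[y, w]]. Neither coordinate is an end, so [(s, t)] is on the graph of [f'] as well, although
     [f'] is already [\top] to the left of [s]. *)
  apply/eqP; rewrite -lex0 leNgt; apply/negP => /(cm_between Xinf Xhom)[t [t0 tf]].
  have [s fst] := completed_graph_level t fm.
  have sw : s <= w.
    by rewrite leNgt; apply/negP => /fst.1 /=; rewrite leNgt tf.
  have ys : y <= s.
    rewrite leNgt; apply/negP => sy.
    have [z [sz zy]] := cm_between Xinf Xhom sy.
    by have := fst.2 z sz; rewrite (fbot z zy) /= leNgt t0.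
  have xs := lt_le_trans xy ys.
  have [s' [t' [fst' se te]]] := sub s t fst.
  have s'E := end_equiv_between xs (le_lt_trans sw w1) se; subst s'.
  have t1 : t < \top by apply: lt_le_trans tf (lex1 _).
  have t'E := end_equiv_between t0 t1 te; subst t'.
  have [z [xz zs]] := cm_between Xinf Xhom xs.
  by have := fst'.1 z zs; rewrite (ftop z xz) /= leNgt t1.
- rewrite /f_minus; case: leP => [|w0].
    by rewrite lex0 => /eqP->.
  apply/eqP; rewrite -le1x leNgt; apply/negP => /(cm_between Xinf Xhom)[t [tf t1]].
  have [s fst] := completed_graph_level t fm'.
  have ws : w <= s.
    by rewrite leNgt; apply/negP => /fst.2 /=; rewrite leNgt tf.
  have sx : s <= x.
    rewrite leNgt; apply/negP => xs.
    have [z [xz zs]] := cm_between Xinf Xhom xs.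
    by have := fst.1 z zs; rewrite (ftop z xz) /= leNgt t1.
  have sy := le_lt_trans sx xy.
  have [s' [t' [fst' se te]]] := sub' s t fst.
  have s'E := end_equiv_between (lt_le_trans w0 ws) sy se; subst s'.
  have t0 : \bot < t by apply: le_lt_trans (le0x _) tf.
  have t'E := end_equiv_between t0 t1 te; subst t'.
  have [z [sz zy]] := cm_between Xinf Xhom sy.
  by have := fst'.2 z sz; rewrite (fbot z zy) /= leNgt t0.
Qed.

(** If [(s, t)] violates the condition for one map at [u], an argument strictly between [u] and [s]
    bounds the other map by [t] on the opposite side. *)
Lemma completed_graph_crossing f f' : end_monotone f -> end_monotone f' ->
  completed_graph f <> completed_graph f' ->
  exists x y, x < y /\ (f y < f' x \/ f' y < f x).
Proof.
move=> [fm _ _] [fm' _ _] ff'.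
suff main h h' p : {homo h : s t / s <= t} -> completed_graph h p ->
    ~ completed_graph h' p -> exists x y, x < y /\ (h y < h' x \/ h' y < h x).
  have [/existsNP[p /not_implyP[hp nhp]]|sub] :=
    pselect (~ (completed_graph f `<=` completed_graph f')).
    exact: main fm hp nhp.
  have [/existsNP[p /not_implyP[hp nhp]]|sub'] :=
    pselect (~ (completed_graph f' `<=` completed_graph f)).
    have [x [y [xy h]]] := main _ _ _ fm' hp nhp.
    by exists x, y; split => //; case: h; [right|left].
  by case: ff'; apply/seteqP; split; exact: contrapT.
case: p => s t hm [/= below above] /not_andP[|] /existsNP[u /not_implyP[/= us /negP]];
  rewrite -ltNge => hu.
- have [y [uy ys]] := cm_between Xinf Xhom us.
  by exists u, y; split => //; left; exact: le_lt_trans (below y ys) hu.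
- have [x [sx xu]] := cm_between Xinf Xhom us.
  by exists x, u; split => //; right; exact: lt_le_trans hu (above x sx).
Qed.

Lemma end_sub_completed_graph f f' : end_monotone f -> end_monotone f' ->
  end_sub (completed_graph f) (completed_graph f') ->
  end_sub (completed_graph f') (completed_graph f) ->
  completed_graph f = completed_graph f' \/
  (completed_graph f = graph_A X /\ completed_graph f' = graph_B X) \/
  (completed_graph f = graph_B X /\ completed_graph f' = graph_A X).
Proof.
move=> fM fM' sub sub'.
have [|/(completed_graph_crossing fM fM')[x [y [xy [h|h]]]]] :=
  pselect (completed_graph f = completed_graph f'); first by left.
- have [-> ->] := crossing_end_sub fM fM' sub sub' xy h; right; left.
  by rewrite completed_graph_f_plus_top completed_graph_f_minus_bot.
- have [-> ->] := crossing_end_sub fM' fM sub' sub xy h; right; right.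
  by rewrite completed_graph_f_plus_top completed_graph_f_minus_bot.
Qed.

Lemma end_sub_graph_AB : end_sub (graph_A X) (graph_B X).
Proof.
move=> s t [[_ /= ->]|[/= -> _]].
- exists s, \top; split; [by right|by left|].
  by right; split; [left|right].
- exists \bot, t; split; [by left| |by left].
  by right; split; [right|left].
Qed.

Lemma end_sub_graph_BA : end_sub (graph_B X) (graph_A X).
Proof.
move=> s t [[/= -> _]|[_ /= ->]].
- exists \top, t; split; [by right| |by left].
  by right; split; [left|right].
- exists s, \bot; split; [by left|by left|].
  by right; split; [right|left].
Qed.

End CompletedGraph.
(** * Comparison of the Ellis and graph compactifications *)

Section Comparisons.
Context {d : Order.disp_t} {X : orderTopologicalType d}.
Hypotheses (Xinf : infinite_set [set: X]) (Xhom : ultrahomogeneous X).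
Local Open Scope order_scope.
Implicit Types (s t u : cm X) (g : aut X) (F : set_system (aut X)).

Lemma cm_hausdorff : hausdorff_space (cm X). Proof. exact: order_hausdorff. Qed.

Lemma cm2_compact : compact [set: cm X * cm X].
Proof. by apply: prod_compact; exact: cm_compact Xinf Xhom. Qed.

Lemma cm2_regular : regular_space (cm X * cm X)%type.
Proof.
apply: compact_hausdorff_regular cm2_compact.
by apply: prod_hausdorff; exact: cm_hausdorff.
Qed.

Lemma b_cm_regular : regular_space (b_cm X).
Proof.
apply/set_type_regular/compact_hausdorff_regular.
  exact: hyper_hausdorff cm2_regular.
exact: hyper_compact cm2_compact.
Qed.

Lemma b_cm_compact : compact [set: b_cm X].
Proof.
apply: set_type_compact; last exact: closed_closure.
exact: hyper_compact cm2_compact.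
Qed.

Lemma b_cm_hausdorff : hausdorff_space (b_cm X).
Proof. apply: set_type_hausdorff; exact: hyper_hausdorff cm2_regular. Qed.

Lemma e_cm_compact : compact [set: e_cm X].
Proof.
apply: set_type_compact; last exact: closed_closure.
by apply: ptws_compact; exact: cm_compact Xinf Xhom.
Qed.

Lemma e_cX_hausdorff : hausdorff_space (e_cX X).
Proof. by apply/set_type_hausdorff/ptws_hausdorff; exact: cX_hausdorff. Qed.

Lemma cX_compact : compact [set: cX X].
Proof.
rewrite (_ : setT = collapse_pi [set \bot; \top : cm X] @` setT).
  apply: continuous_compact; last exact: cm_compact Xinf Xhom.
  apply: continuous_subspaceT; exact: collapse_pi_continuous.
apply/seteqP; split=> // q _; exists (collapse_repr q) => //.
exact: collapse_reprK.
Qed.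

Lemma b_cX_hausdorff : hausdorff_space (b_cX X).
Proof.
apply: set_type_hausdorff; apply: hyper_hausdorff.
apply: compact_hausdorff_regular.
  by apply: prod_hausdorff; exact: cX_hausdorff.
by apply: prod_compact; exact: cX_compact.
Qed.

Lemma b_cm_ultra_cvg F : UltraFilter F -> exists q : b_cm X, ext_emb (b_cm X) @ F --> q.
Proof.
move=> FU; have := b_cm_compact; rewrite compact_ultra.
move=> /(_ (ext_emb (b_cm X) @ F) (fmap_ultra _ FU) filterT)[q [_ Fq]].
by exists q.
Qed.

Lemma limit_graph_mem F (q : b_cm X) p : ProperFilter F -> ext_emb (b_cm X) @ F --> q ->
  limit_graph q p <->
  (forall U, open U -> U p -> F [set g | graph (cm_act g) `&` U !=set0]).
Proof.
move=> FF /closure_ext_val_cvg Fq.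
exact: (@hyper_limP _ _ (\val q) p cm2_regular _ Fq).
Qed.

Lemma limit_graphE F (q : b_cm X) (f : cm X -> cm X) : ProperFilter F ->
  (forall t, (fun g => cm_act g t) @ F --> f t) -> ext_emb (b_cm X) @ F --> q ->
  limit_graph q = completed_graph f.
Proof.
move=> FF Ff Fq; apply/seteqP; split=> p.
  by move/(limit_graph_mem p FF Fq)/(limit_completed_graph Xinf Xhom FF Ff p).
by move/(limit_completed_graph Xinf Xhom FF Ff p)/(limit_graph_mem p FF Fq).
Qed.

Lemma limit_graph_inj : injective (@limit_graph _ X).
Proof. by move=> p q pq; apply: val_inj; exact: hyper_eqP. Qed.

Lemma e_cm_val_cvg F (p : e_cm X) t : Filter F -> ext_emb (e_cm X) @ F --> p ->
  (fun g => cm_act g t) @ F --> \val p t.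
Proof.
move=> FF /closure_ext_val_cvg Fp W pW.
exact: (Fp _ (@ptws_eval_continuous _ _ t _ _ pW)).
Qed.

Lemma e_cm_end_monotone (p : e_cm X) : end_monotone (\val p).
Proof. by apply: (ellis_end_monotone Xinf Xhom); exact: set_mem (valP p). Qed.

(** Ultrafilters with the same pointwise limit have the same limit graph by [limit_graphE], which is
    the uniqueness that [ext_ge_ultra] asks for. *)
Lemma e_cm_b_cm : exists h : e_cm X -> b_cm X, [/\ continuous h,
  forall g, h (ext_emb (e_cm X) g) = ext_emb (b_cm X) g &
  forall p, limit_graph (h p) = completed_graph (\val p)].
Proof.
have [|F F' p q q' FU F'U Fp F'p Fq F'q'|h hc he] :=
  @ext_ge_ultra _ (e_cm X) (b_cm X) b_cm_regular.
- exact: b_cm_ultra_cvg.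
- apply: limit_graph_inj.
  rewrite (@limit_graphE F q (\val p)) // => [|t]; last exact: e_cm_val_cvg.
  by rewrite (@limit_graphE F' q' (\val p)) // => t; exact: e_cm_val_cvg.
exists h; split => // p; have [F FU Fp] := ext_ultra p.
by apply: (@limit_graphE F) => [t|]; [exact: e_cm_val_cvg|exact: ext_map_cvg Fp].
Qed.

Lemma limit_graph_ex (q : b_cm X) :
  exists2 p : e_cm X, limit_graph q = completed_graph (\val p) & end_monotone (\val p).
Proof.
have [h [hc he hg]] := e_cm_b_cm.
have [p <-] := ext_map_surj e_cm_compact b_cm_hausdorff hc he q.
by exists p => //; exact: e_cm_end_monotone.
Qed.

Lemma e_cm_cut (f : cm X -> cm X) : cut_map f -> exists p : e_cm X, \val p = f.
Proof.
move=> /(cut_map_ellis Xinf Xhom) Sf.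
by exists (exist (fun z => z \in closure _) (f : {ptws cm X -> cm X}) (mem_set Sf)).
Qed.

Lemma limit_graph_A_ex : exists F : b_cm X, limit_graph F = graph_A X.
Proof.
have [h [_ _ hg]] := e_cm_b_cm.
have [|p pE] := @e_cm_cut (f_plus \top).
  by apply: f_plus_cut; rewrite gt_eqF // (cm_bot_lt_top Xinf Xhom).
by exists (h p); rewrite hg pE completed_graph_f_plus_top.
Qed.

Lemma limit_graph_B_ex : exists F : b_cm X, limit_graph F = graph_B X.
Proof.
have [h [_ _ hg]] := e_cm_b_cm.
have [|p pE] := @e_cm_cut (f_minus \bot).
  by apply: f_minus_cut; rewrite lt_eqF // (cm_bot_lt_top Xinf Xhom).
by exists (h p); rewrite hg pE completed_graph_f_minus_bot.
Qed.

Local Notation pi := (collapse_pi [set \bot; \top : cm X]).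

Definition pi2 (p : cm X * cm X) : (cX X * cX X)%type := (pi p.1, pi p.2).

Lemma pi2_continuous : continuous pi2.
Proof.
move=> [s t] W [[A B] [/= As Bt] AB].
exists (pi @^-1` A, pi @^-1` B); first by split;
  [exact: (collapse_pi_continuous As)|exact: (collapse_pi_continuous Bt)].
by move=> [a b] [/= Aa Bb]; exact: AB.
Qed.

Lemma cX_act_pi g s : cX_act g (pi s) = pi (cm_act g s).
Proof.
apply: collapse_map_pi => t [->|->]; [left|right]; [exact: cm_act_bot|exact: cm_act_top].
Qed.

Lemma cX2_hausdorff : hausdorff_space (cX X * cX X)%type.
Proof. by apply: prod_hausdorff; exact: cX_hausdorff. Qed.

Lemma b_cm_b_cX : exists k : b_cm X -> b_cX X, [/\ continuous k,
  forall g, k (ext_emb (b_cm X) g) = ext_emb (b_cX X) g &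
  forall p, hyper_set (\val (k p)) = pi2 @` limit_graph p].
Proof.
have [|g|k [kc ke kv]] := closure_ext_map
  (i := graph_map (@order_hausdorff _ (cm X)) (@cm_act_continuous _ X))
  (i' := graph_map (@cX_hausdorff _ X) (@cX_act_continuous _ X))
  (f := hyper_image cm2_compact cX2_hausdorff pi2_continuous).
- exact: hyper_image_continuous.
- apply: hyper_eqP; apply/seteqP; split=> /=.
    by move=> _ [[s t] + <-]; rewrite /graph /= => ->; rewrite cX_act_pi.
  move=> [a b]; rewrite /graph /= => ->.
  exists (collapse_repr a, cm_act g (collapse_repr a)) => //=.
  by rewrite /pi2 /= -cX_act_pi collapse_reprK.
by exists k; split => // p; rewrite kv.
Qed.

Lemma pi2_image_end_sub (A B : set (cm X * cm X)) :
  pi2 @` A `<=` pi2 @` B <-> end_sub A B.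
Proof.
split=> [AB s t Ast|AB _ [[s t] Ast <-]].
  have [[s' t'] Bst' [/esym/collapse_eqP se /esym/collapse_eqP te]] :
    (pi2 @` B) (pi2 (s, t)) by apply: AB; exists (s, t).
  by exists s', t'.
have [s' [t' [Bst' /collapse_eqP se /collapse_eqP te]]] := AB s t Ast.
by exists (s', t'); rewrite // /pi2 /= se te.
Qed.

Lemma b_cX_fibre (k : b_cm X -> b_cX X) p q :
  (forall p, hyper_set (\val (k p)) = pi2 @` limit_graph p) ->
  k p = k q <-> p = q \/ zero_K X p /\ zero_K X q.
Proof.
move=> kv.
have -> : k p = k q <-> pi2 @` limit_graph p = pi2 @` limit_graph q.
  rewrite -!kv; split=> [->//|pq]; apply: val_inj; exact: hyper_eqP.
split=> [/seteqP[/pi2_image_end_sub pq /pi2_image_end_sub qp]|[->//|]].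
  have [f pE fm] := limit_graph_ex p; have [f' qE fm'] := limit_graph_ex q.
  rewrite pE qE in pq qp.
  have [e|[[e1 e2]|[e1 e2]]] := end_sub_completed_graph Xinf Xhom fm fm' pq qp.
  - by left; apply: limit_graph_inj; rewrite pE qE.
  - by right; rewrite /zero_K /= pE qE; split; [left|right].
  - by right; rewrite /zero_K /= pE qE; split; [right|left].
have [AB BA] := (@end_sub_graph_AB _ X, @end_sub_graph_BA _ X).
move=> [[->|->] [->|->]] //; apply/seteqP;
  by split; apply/pi2_image_end_sub.
Qed.

Lemma b_cX_collapse : ext_eq (b_cX X) (collapse_extension (zero_K X)).
Proof.
have [k [kc ke kv]] := b_cm_b_cX.
apply: collapse_ext_eq b_cm_compact b_cX_hausdorff kc ke _ => p q.
exact: b_cX_fibre kv.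
Qed.

Lemma e_cm_e_cX : exists k : e_cm X -> e_cX X, [/\ continuous k,
  forall g, k (ext_emb (e_cm X) g) = ext_emb (e_cX X) g &
  forall p s, \val (k p) (pi s) = pi (\val p s)].
Proof.
(* Evaluating at chosen representatives makes [c] continuous at every [f]; it commutes with [pi] for
   those [f] that preserve the pair of ends, as limit maps do. *)
pose c (f : {ptws cm X -> cm X}) : {ptws cX X -> cX X} :=
  @collapse_map _ [set \bot; \top : cm X] f.
have cc : continuous c.
  move=> f; apply: ptws_cvg => [|t W hW].
    by apply: fmap_filter; exact: nbhs_filter.
  exact: (@ptws_eval_continuous _ _ (collapse_repr t) f _ (collapse_pi_continuous hW)).
have [k [kc ke kv]] := closure_ext_map (i := ellis_map (@cm_act _ X))
  (i' := ellis_map (@cX_act _ X)) cc (fun g => erefl).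
exists k; split => // p s; rewrite kv; apply: collapse_map_pi.
have [_ f0 f1] := e_cm_end_monotone p.
by move=> t [->|->]; [left|right].
Qed.

(** Where the maps differ, one is [\bot] and the other [\top]. By monotonicity the first is [\bot]
    to the left and the second [\top] to the right, and on each side equality in [cX] makes the
    remaining map take an end as value. *)
Lemma e_cX_fibre (k : e_cm X -> e_cX X) p q :
  (forall p s, \val (k p) (pi s) = pi (\val p s)) ->
  k p = k q <-> p = q \/ I_ideal X p /\ I_ideal X q.
Proof.
move=> kv; have bt := cm_bot_lt_top Xinf Xhom.
have kE : k p = k q <-> forall s, end_equiv (\val p s) (\val q s).
  split=> [kpq s|h].
    by apply/collapse_eqP; rewrite -!kv kpq.
  apply: val_inj; apply/funext => a; rewrite -(collapse_reprK a) !kv.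
  by apply/collapse_eqP; exact: h.
have [pm p0 p1] := e_cm_end_monotone p; have [qm q0 q1] := e_cm_end_monotone q.
rewrite kE; split=> [h|[->|[/(I_mapsP Xinf Xhom)[_ pE] /(I_mapsP Xinf Xhom)[_ qE]]] s].
- have [pq|/existsNP[t pqt]] := pselect (forall t, \val p t = \val q t).
    by left; apply/val_inj/funext.
  right.
  have ends (f f' : cm X -> cm X) : {homo f : s t / s <= t} -> {homo f' : s t / s <= t} ->
      (forall s, end_equiv (f s) (f' s)) -> f t = \bot -> f' t = \top ->
      forall s, (f s = \bot \/ f s = \top) /\ (f' s = \bot \/ f' s = \top).
    move=> fm fm' ff' ft ft' s.
    have [st|ts] := leP s t.
      have fs : f s = \bot by apply/eqP; rewrite -lex0 -ft; exact: fm.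
      by have [<-|[]//] := ff' s; rewrite fs; split; left.
    have fs : f' s = \top by apply/eqP; rewrite -le1x -ft'; exact/fm'/ltW.
    by have [->|[]//] := ff' s; rewrite fs; split; right.
  have h' s : end_equiv (\val q s) (\val p s).
    by have [->|[a b]] := h s; [left|right].
  suff E s : (\val p s = \bot \/ \val p s = \top) /\ (\val q s = \bot \/ \val q s = \top).
    by split; apply/(I_mapsP Xinf Xhom); split => // s; have [] := E s.
  have [//|[[pt|pt] [qt|qt]]] := h t.
  - by move: pqt; rewrite pt qt.
  - exact: (ends _ _ pm qm h pt qt).
  - by have [] := ends _ _ qm pm h' qt pt s.
  - by move: pqt; rewrite pt qt.
- by left.
- by right; split; [exact: pE|exact: qE].
Qed.

Lemma e_cX_collapse : ext_eq (e_cX X) (collapse_extension (I_ideal X)).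
Proof.
have [k [kc ke kv]] := e_cm_e_cX.
apply: collapse_ext_eq e_cm_compact e_cX_hausdorff kc ke _ => p q.
exact: e_cX_fibre kv.
Qed.

End Comparisons.

(** * Incomparability of graph and Ellis compactifications *)

Section Incomparability.
Context {d : Order.disp_t} {X : orderTopologicalType d}.
Hypotheses (Xinf : infinite_set [set: X]) (Xhom : ultrahomogeneous X).
Local Open Scope order_scope.
Implicit Types (x y : X) (g : aut X).

Section FixedCutFilter.
Variable y : X.

Definition fixed_cut_filter : set_system (aut X) :=
  filter_from [set p : (X * X) * (X * X) | p.1.1 < y /\ y < p.1.2]
    (fun p => [set g : aut X | [/\ g y = y, g p.1.1 < p.2.1 & p.2.2 < g p.1.2]]).

(** A third value at the jump, besides those of [f_minus] and [f_plus]; it stays distinct from the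
    ends in [cX]. *)
Definition fixed_cut (t : cm X) : cm X :=
  if t < cm_pt y then \bot else if t == cm_pt y then cm_pt y else \top.

Lemma fixed_cut_filter_proper : ProperFilter fixed_cut_filter.
Proof.
apply: filter_from_proper => [|[[a b] [u v]] [/= ay yb]].
  apply: filter_from_filter.
    have [a ay] := lt_ex Xinf Xhom y; have [b yb] := gt_ex Xinf Xhom y.
    by exists ((a, b), (y, y)).
  move=> [[a b] [u v]] [[a' b'] [u' v']] [/= ay yb] [/= a'y yb'].
  exists ((Order.max a a', Order.min b b'), (Order.min u u', Order.max v v')) => /=.
    by rewrite gt_max lt_min ay a'y yb yb'.
  move=> g /= [gy gau vgb]; split; split => //.
  - apply: le_lt_trans (lt_le_trans gau _); first by rewrite aut_le le_max lexx.
    by rewrite ge_min lexx.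
  - apply: lt_le_trans (le_lt_trans _ vgb) _; last by rewrite aut_le ge_min lexx.
    by rewrite le_max lexx.
  - apply: le_lt_trans (lt_le_trans gau _); first by rewrite aut_le le_max lexx orbT.
    by rewrite ge_min lexx orbT.
  - apply: lt_le_trans (le_lt_trans _ vgb) _; last by rewrite aut_le ge_min lexx orbT.
    by rewrite le_max lexx orbT.
have [p pm] := lt_ex Xinf Xhom (Order.min u y).
have [q qm] := gt_ex Xinf Xhom (Order.max v y).
move: pm qm; rewrite lt_min gt_max => /andP[pu py] /andP[vq yq].
have ab := lt_trans ay yb; have pq := lt_trans py yq.
have [|g gP] := @increasing_extension _ _ Xhom [:: a; y; b]
    (fun z => if z < y then p else if z == y then y else q).
  move=> z w; rewrite !inE => /or3P[]/eqP-> /or3P[]/eqP->;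
    rewrite ?ltxx ?eqxx ?ay ?(gt_eqF yb) ?(lt_gtF yb) //.
  - by rewrite ltNge ltW.
  - by rewrite ltNge ltW.
exists g; split => /=.
- by rewrite gP ?inE ?eqxx ?orbT // ltxx.
- by rewrite gP ?inE ?eqxx // ay.
- by rewrite gP ?inE ?eqxx ?orbT // (lt_gtF yb) (gt_eqF yb).
Qed.

Lemma fixed_cut_filter_cvg t :
  (fun g : aut X => cm_act g t) @ fixed_cut_filter --> fixed_cut t.
Proof.
have FF := fixed_cut_filter_proper.
have [a ay] := lt_ex Xinf Xhom y; have [b yb] := gt_ex Xinf Xhom y.
rewrite /fixed_cut; case: ltP => [ty|]; last rewrite le_eqVlt => /orP[/eqP<-|yt].
- have [x [tx]] := cm_lt_pt Xinf Xhom ty; rewrite cm_pt_lt => xy.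
  apply: order_cvg => [c|c c0]; first by rewrite ltNge le0x.
  have [u [_ uc]] := cm_lt_pt Xinf Xhom c0.
  exists ((x, b), (u, y)) => //= g [/= _ gxu _].
  apply: lt_trans uc; apply: lt_trans (_ : cm_act g (cm_pt x) < _).
    by rewrite cm_act_lt.
  by rewrite cm_act_pt cm_pt_lt.
- rewrite eqxx => W yW; exists ((a, b), (y, y)) => //= g [/= gy _ _].
  by rewrite cm_act_pt gy; exact: nbhs_singleton.
- rewrite (gt_eqF yt).
  have [x [+ xt]] := cm_lt_pt Xinf Xhom yt; rewrite cm_pt_lt => yx.
  apply: order_cvg => [c c1|c]; last by rewrite ltNge lex1.
  have [v [cv _]] := cm_lt_pt Xinf Xhom c1.
  exists ((a, x), (y, v)) => //= g [/= _ _ vgx].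
  apply: lt_trans cv _; apply: lt_trans (_ : _ < cm_act g (cm_pt x)) _.
    by rewrite cm_act_pt cm_pt_lt.
  by rewrite cm_act_lt.
Qed.

(** The maps differ only at [y], and a bound demanded at [u = y] follows from one at a point
    strictly between [y] and [s], where both maps already have the same end as value. *)
Lemma completed_graph_fixed_cut :
  completed_graph fixed_cut = completed_graph (f_minus (cm_pt y)).
Proof.
have below t : t < cm_pt y -> fixed_cut t = \bot /\ f_minus (cm_pt y) t = \bot.
  by move=> ty; rewrite /fixed_cut /f_minus ty ltW.
have above t : cm_pt y < t -> fixed_cut t = \top /\ f_minus (cm_pt y) t = \top.
  by move=> yt; rewrite /fixed_cut /f_minus (lt_gtF yt) (gt_eqF yt) (lt_geF yt).
suff main f f' : (forall t, t < cm_pt y -> f t = \bot /\ f' t = \bot) ->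
    (forall t, cm_pt y < t -> f t = \top /\ f' t = \top) ->
    completed_graph f `<=` completed_graph f'.
  apply/seteqP; split; first exact: main below above.
  by apply: main => t ty; [have [] := below t ty|have [] := above t ty].
move=> lo hi [s t] [/= fs1 fs2]; split=> u /= us.
- have [v [uv vs]] := cm_between Xinf Xhom us.
  have := fs1 _ us; have := fs1 _ vs.
  have [uy|uy|uy] := ltgtP u (cm_pt y).
  + by rewrite (lo u uy).2 le0x.
  + by rewrite (hi u uy).1 (hi u uy).2.
  + have yv : cm_pt y < v by rewrite -uy.
    rewrite (hi v yv).1 => /(le_trans (lex1 _)) h _; exact: h.
- have [v [sv vu]] := cm_between Xinf Xhom us.
  have := fs2 _ us; have := fs2 _ sv.
  have [uy|uy|uy] := ltgtP u (cm_pt y).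
  + by rewrite (lo u uy).1 (lo u uy).2.
  + by rewrite (hi u uy).2 lex1.
  + have yv : v < cm_pt y by rewrite -uy.
    rewrite (lo v yv).1 => h _; exact: le_trans h (le0x _).
Qed.

End FixedCutFilter.

Lemma cm_pt_not_end (y : X) : cm_pt y <> \bot /\ cm_pt y <> \top.
Proof.
have b := cm_bot_lt_pt Xinf Xhom y; have t := cm_pt_lt_top Xinf Xhom y.
by split=> yE; move: b t; rewrite yE ltxx.
Qed.

Lemma e_cm_f_minus (y : X) : exists p : e_cm X, \val p = f_minus (cm_pt y).
Proof.
apply: (e_cm_cut Xinf Xhom); apply: f_minus_cut; apply/eqP.
exact: (cm_pt_not_end y).2.
Qed.

(** The filter fixing [y] has the limit graph of [f_minus (cm_pt y)], so a comparison map would give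
    both the same limit in the Ellis compactification of [cX]. At the class of [y] one limit gives
    that class and the other the class of the ends. *)
Lemma b_cm_not_ge_e_cX : ~ ext_ge (b_cm X) (e_cX X).
Proof.
move=> [k kc ke]; have [y _] := three_points Xinf.
have [h [hc he hg]] := e_cm_b_cm Xinf Xhom.
have [l [lc le lv]] := e_cm_e_cX Xinf Xhom.
have [p pE] := e_cm_f_minus y.
have [F [FU sF]] := ultraFilterLemma (fixed_cut_filter_proper y).
have [q Fq] := b_cm_ultra_cvg Xinf Xhom FU.
have qE : q = h p.
  apply: limit_graph_inj; rewrite hg pE -completed_graph_fixed_cut.
  apply: (limit_graphE Xinf Xhom _ _ Fq) => t.
  by move=> W tW; apply: sF; exact: (fixed_cut_filter_cvg tW).
have klp : k q = l p.
  rewrite qE; apply: (ext_map_unique (h := k \o h)) => //.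
  - exact: e_cX_hausdorff.
  - by move=> r; apply: continuous_comp; [exact: hc|exact: kc].
  - by move=> g; rewrite /= he ke.
pose pi := collapse_pi [set \bot; \top : cm X].
have Fk : ext_emb (e_cX X) @ F --> k q by exact: ext_map_cvg Fq.
have F1 : (fun g => cX_act g (pi (cm_pt y))) @ F --> \val (k q) (pi (cm_pt y)).
  have Fv : ellis_map (@cX_act _ X) @ F --> (\val (k q) : {ptws cX X -> cX X}).
    exact: closure_ext_val_cvg Fk.
  by move=> W qW; exact: (Fv _ (@ptws_eval_continuous _ _ (pi (cm_pt y)) _ _ qW)).
have F2 : (fun g => cX_act g (pi (cm_pt y))) @ F --> pi (cm_pt y).
  move=> W yW; apply: sF.
  have [a ay] := lt_ex Xinf Xhom y; have [b yb] := gt_ex Xinf Xhom y.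
  exists ((a, b), (y, y)) => //= g [/= gy _ _].
  by rewrite cX_act_pi cm_act_pt gy; exact: nbhs_singleton.
have := cvg_unique (@cX_hausdorff _ X) F1 F2.
rewrite klp lv pE /f_minus lexx => /(_ _)/collapse_eqP[|[_ []]].
- by move/esym; exact: (cm_pt_not_end y).1.
- exact: (cm_pt_not_end y).1.
- exact: (cm_pt_not_end y).2.
Qed.

(** Two steps at [y < z] agree in the Ellis compactification of [cX]. The point [(y, y)] is on the
    vertical segment of the first graph, but not on the second graph, nor on [A] or [B]. *)
Lemma e_cX_not_ge_b_cX : ~ ext_ge (e_cX X) (b_cX X).
Proof.
move=> [k kc ke]; have [y [z [_ [yz _]]]] := three_points Xinf.
have [h [hc he hg]] := e_cm_b_cm Xinf Xhom.
have [m [mc me mv]] := b_cm_b_cX Xinf Xhom.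
have [l [lc le lv]] := e_cm_e_cX Xinf Xhom.
have [p pE] := e_cm_f_minus y; have [q qE] := e_cm_f_minus z.
have Iminus r x : \val r = f_minus (cm_pt x) -> I_ideal X r.
  move=> rE; left; exists (cm_pt x) => //=; apply/eqP; exact: (cm_pt_not_end x).2.
have lpq : l p = l q.
  by apply/(e_cX_fibre Xinf Xhom p q lv); right; split; [exact: Iminus pE|exact: Iminus qE].
have mhE : m \o h =1 k \o l.
  apply: ext_map_unique.
  - exact: b_cX_hausdorff.
  - by move=> r; apply: continuous_comp; [exact: hc|exact: mc].
  - by move=> r; apply: continuous_comp; [exact: lc|exact: kc].
  - by move=> g; rewrite /= he me.
  - by move=> g; rewrite /= le ke.
have hp : limit_graph (h p) (cm_pt y, cm_pt y).
  rewrite hg pE; split=> u /= uy; rewrite /f_minus.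
    by rewrite (ltW uy) le0x.
  by rewrite (lt_geF uy) lex1.
have /(b_cX_fibre Xinf Xhom (h p) (h q) mv)[hpq|[hK _]] : m (h p) = m (h q).
  by have := mhE p; have := mhE q; rewrite /= => -> ->; rewrite lpq.
- move: hp; rewrite hpq hg qE => -[_ /=].
  have [x [yx xz]] := between_ex Xinf Xhom yz.
  move/(_ (cm_pt x)); rewrite cm_pt_lt => /(_ yx).
  rewrite /f_minus cm_pt_le (ltW xz) leNgt.
  by rewrite (cm_bot_lt_pt Xinf Xhom).
- have [y0 y1] := cm_pt_not_end y.
  by case: hK => hE; rewrite hE in hp; case: hp => -[] //=.
Qed.

End Incomparability.
(** * The Roelcke compactification *)

Section UniformSeparation.
Context (R : realType) (U : uniformType) (A B : set U) (E : set (U * U)).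
Hypotheses (Eent : entourage E) (ABE : forall a b, A a -> B b -> ~ E (a, b)).
Local Open Scope ring_scope.

Local Notation gaugeU := [the pseudoMetricType R of gauge.type Eent].

(* The function is the distance to [A], truncated, for a pseudometric whose
   entourages include [E]. *)
Lemma ucb_separation : exists (f : ucb_fun R U) (e : R),
  [/\ 0 < e, forall a, A a -> f a = 0 & forall b, B b -> f b = e].
Proof.
have [e [e0 AB]] : exists e : R, 0 < e /\
    forall x y : gaugeU, A x -> B y -> ~ ball x e y.
  have : @entourage gaugeU E by exists 0%N => // -[x y] [].
  rewrite -entourage_ballE => -[e /= e0 eE]; exists e; split => // x y Ax By xy.
  exact: ABE Ax By (eE (x, y) xy).
(* Including [e] truncates the distance at [e] and keeps the set nonempty. *)
pose S (z : gaugeU) : set R :=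
  [set r | r = e \/ 0 < r /\ exists2 a : gaugeU, A a & ball a r z].
pose D z := inf (S z).
have Slb z : lbound (S z) 0 by move=> r [->|[/ltW]] //; exact: ltW.
have S0 z : S z !=set0 by exists e; left.
have D0 z : 0 <= D z by exact: lb_le_inf.
have De z : D z <= e by apply: ge_inf; [exists 0|left].
have Dball r (z w : gaugeU) : 0 < r -> ball z r w -> D w <= D z + r.
  move=> r0 zw; rewrite -lerBlDr; apply: lb_le_inf => // s [->|[s0 [a Aa az]]].
    by rewrite lerBlDr (le_trans (De w)) // lerDl ltW.
  rewrite lerBlDr; apply: ge_inf; first by exists 0.
  right; split; first exact: addr_gt0.
  by exists a => //; exact: ball_triangle zw.
have Duc : unif_continuous (D : U -> R).
  move=> V; rewrite -entourage_ballE => -[r /= r0 rV].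
  apply: (gauge.gauge_ent Eent); suff : @entourage gaugeU
    [set xy | V (D xy.1, D xy.2)] by [].
  rewrite -entourage_ballE; exists (r / 2) => /=; first by rewrite divr_gt0.
  have r2 : 0 < r / 2 by rewrite divr_gt0.
  move=> [x y] /= xy; apply: rV; rewrite /ball /= ltr_norml.
  have h1 := Dball _ _ _ r2 xy; have h2 := Dball _ _ _ r2 (ball_sym xy).
  have hr : r / 2 < r by rewrite ltr_pdivrMr // ltr_pMr // ltrDl.
  rewrite ltrBlDr ltrNl opprB ltrBlDr addrC (le_lt_trans h1) ?ltrD2l //=.
  by rewrite addrC (le_lt_trans h2) // ltrD2l.
have Dbd : exists M : R, forall x, `|D x| <= M.
  by exists e => x; rewrite ger0_norm.
exists (UcbFun Duc Dbd), e; split => //= [a Aa|b Bb]; apply/eqP; rewrite eq_le.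
  rewrite D0 andbT; apply/ler_addgt0Pr => r r0; rewrite add0r.
  by apply: ge_inf; [exists 0|right; split => //; exists a => //; exact: ballxx].
rewrite De /=; apply: lb_le_inf => // r [->//|[r0 [a Aa ab]]].
rewrite leNgt; apply/negP => re; apply: (AB a b Aa Bb).
exact: le_ball (ltW re) _ ab.
Qed.

End UniformSeparation.
Section RoelckeGraph.
Context {d : Order.disp_t} {X : orderTopologicalType d}.
Hypotheses (Xinf : infinite_set [set: X]) (Xhom : ultrahomogeneous X).
Local Open Scope order_scope.
Implicit Types (x y z p q : X) (a b g h : aut X) (F : set_system (aut X)) (P : seq X).

(** A triple lists a left bound, a point and a right bound; two-sided bounds are available as [X]
    has no end points. The filter generated by these conditions converges pointwise to the
    identity. *)
Lemma aut_nbhs1 (O : set (aut X)) : nbhs (1%g : aut X) O ->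
  exists s : seq (X * X * X),
    (forall t, t \in s -> t.1.1 < t.1.2 /\ t.1.2 < t.2) /\
    [set a : aut X | forall t, t \in s -> t.1.1 < a t.1.2 /\ a t.1.2 < t.2] `<=` O.
Proof.
pose D : set (seq (X * X * X)) :=
  [set s | forall t, t \in s -> t.1.1 < t.1.2 /\ t.1.2 < t.2].
pose N (s : seq (X * X * X)) :=
  [set a : aut X | forall t, t \in s -> t.1.1 < a t.1.2 /\ a t.1.2 < t.2].
pose B : set_system (aut X) := filter_from D N.
have FB : Filter B.
  apply: filter_from_filter; first by exists [::].
  move=> s s' Ds Ds'; exists (s ++ s') => [t|a Na].
    by rewrite mem_cat => /orP[/Ds|/Ds'].
  by split=> t ts; apply: Na; rewrite mem_cat ts ?orbT.
have near1 (x y z : X) : y < x -> x < z -> B [set a : aut X | y < a x /\ a x < z].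
  move=> yx xz; exists [:: (y, x, z)] => [t|a Na]; first by rewrite inE => /eqP->.
  exact: Na (mem_head _ _).
have B1 : @aut_ptws _ X @ B --> aut_ptws (1%g : aut X).
  apply: ptws_cvg => x; apply: order_cvg => [l lx|r xr].
    have [r xr] := gt_ex Xinf Xhom x.
    by apply: filterS (near1 x l r lx xr) => a [].
  have [l lx] := lt_ex Xinf Xhom x.
  by apply: filterS (near1 x l r lx xr) => a [].
move=> [/= _ [[W oW <-]] W1 WO].
have [s Ds sW] := B1 W (open_nbhs_nbhs (conj oW W1)).
by exists s; split => // a /sW; exact: WO.
Qed.

(* The intervals around the points of [P] are made pairwise disjoint, so that
   an increasing choice of points needs to respect no other constraint. *)
Lemma aut_nbhs1_disjoint (O : set (aut X)) : nbhs (1%g : aut X) O ->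
  exists P (l r : X -> X), [/\
    forall p, l p < p /\ p < r p,
    {in P &, forall p q, p < q -> r p <= l q} &
    [set a : aut X | {in P, forall p, l p < a p /\ a p < r p}] `<=` O].
Proof.
move=> /aut_nbhs1[s [sP sO]].
(* For [p < q] in [P], the common point [mid (p, q)] will lie above [r p] and below [l q], so that
   [r] and [l] can be chosen independently. *)
have /choice[mid midP] (xy : X * X) : exists m,
    xy.1 < xy.2 -> xy.1 < m /\ m < xy.2.
  case: xy => x y /=.
  have [xy|nxy] := pselect (x < y); last by exists x => /nxy.
  by have [z zP] := between_ex Xinf Xhom xy; exists z.
pose P := [seq t.1.2 | t <- s].
have /choice[r rP] (p : X) : exists m, [/\ p < m,
    forall t, t \in s -> t.1.2 = p -> m < t.2 &
    forall q, q \in P -> p < q -> m < mid (p, q)].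
  have [|r [pr rB]] := seq_separation Xinf Xhom (A := [:: p])
    (B := [seq t.2 | t <- s & t.1.2 == p] ++ [seq mid (p, q) | q <- P & p < q]).
    move=> u v; rewrite inE mem_cat => /eqP-> /orP[]/mapP[t].
      by rewrite mem_filter => /andP[/eqP <- /sP[_ ?]] ->.
    by rewrite mem_filter => /andP[pt _] ->; exact: (midP (p, t) pt).1.
  exists r; split=> [|t ts tp|q qP pq].
  - by apply: pr; rewrite inE.
  - apply: rB; rewrite mem_cat; apply/orP; left; apply: map_f.
    by rewrite mem_filter tp eqxx.
  - apply: rB; rewrite mem_cat; apply/orP; right.
    by apply: (map_f (fun q => mid (p, q))); rewrite mem_filter pq.
have /choice[l lP] (p : X) : exists m, [/\ m < p,
    forall t, t \in s -> t.1.2 = p -> t.1.1 < m &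
    forall q, q \in P -> q < p -> mid (q, p) < m].
  have [|l [lA lp]] := seq_separation Xinf Xhom (B := [:: p])
    (A := [seq t.1.1 | t <- s & t.1.2 == p] ++ [seq mid (q, p) | q <- P & q < p]).
    move=> v u; rewrite inE mem_cat => + /eqP-> => /orP[]/mapP[t].
      by rewrite mem_filter => /andP[/eqP <- /sP[? _]] ->.
    by rewrite mem_filter => /andP[pt _] ->; exact: (midP (t, p) pt).2.
  exists l; split=> [|t ts tp|q qP pq].
  - by apply: lp; rewrite inE.
  - apply: lA; rewrite mem_cat; apply/orP; left.
    by apply: (map_f (fun t => t.1.1)); rewrite mem_filter tp eqxx.
  - apply: lA; rewrite mem_cat; apply/orP; right.
    by apply: (map_f (fun q => mid (q, p))); rewrite mem_filter pq.
exists P, l, r; split=> [p|p q pP qP pq|a aP].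
- by have [pr _ _] := rP p; have [lp _ _] := lP p.
- have [_ _ h] := rP p; have [_ _ k] := lP q.
  exact: ltW (lt_trans (h q qP pq) (k p pP pq)).
- apply: sO => t ts; have tP : t.1.2 \in P by exact: map_f.
  have [_ lt _] := lP t.1.2; have [_ rt _] := rP t.1.2.
  have [la ar] := aP _ tP.
  by split; [exact: lt_trans (lt t ts erefl) la|exact: lt_trans ar (rt t ts erefl)].
Qed.

Section Interpolation.
Variables (P : seq X) (l r : X -> X) (g h : aut X) (sg : X -> X).
Hypothesis lr : forall p, l p < p /\ p < r p.
Hypothesis disj : {in P &, forall p q, p < q -> r p <= l q}.
(** Here [sg p] is the intended value of [b] at [g^-1 p]. The first two conditions bring [h b g^-1]
    close to the identity at [p]; the last leaves room for the values of [b] on [P]. *)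
Hypothesis sgP : forall p, p \in P -> [/\ l p < h (sg p), h (sg p) < r p &
  forall q, q \in P -> (q <= g^-1%g p -> l q < sg p) /\ (g^-1%g p <= q -> sg p < r q)].

Let gK x : g^-1%g (g x) = x. Proof. exact: autK. Qed.
Let gVK x : g (g^-1%g x) = x. Proof. exact: autVK. Qed.

Let sg_lt p q : p \in P -> q \in P -> p < q -> sg p < sg q.
Proof.
move=> pP qP pq; rewrite -(aut_lt h).
have [_ hr _] := sgP pP; have [lh _ _] := sgP qP.
exact: lt_trans hr (le_lt_trans (disj pP qP pq) lh).
Qed.

Lemma interpolating_aut : exists b : aut X,
  {in P, forall p, l p < b p /\ b p < r p} /\
  {in P, forall p, l p < (h * b * g^-1)%g p /\ (h * b * g^-1)%g p < r p}.
Proof.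
have /choice[tau tauP] (q : X) : exists u, q \in P ->
    [/\ l q < u, u < r q,
      forall p, p \in P -> g^-1%g p < q -> sg p < u &
      forall p, p \in P -> q < g^-1%g p -> u < sg p].
  have [qP|nqP] := boolP (q \in P); last by exists q.
  have [|u [uA uB]] := seq_separation Xinf Xhom
    (A := l q :: [seq sg p | p <- P & g^-1%g p < q])
    (B := r q :: [seq sg p | p <- P & q < g^-1%g p]).
    move=> u v; rewrite !inE => /orP[/eqP->|/mapP[p]].
      move=> /orP[/eqP->|/mapP[p]]; first by have [lq qr] := lr q; exact: lt_trans qr.
      rewrite mem_filter => /andP[qp pP] ->.
      by have [_ _ /(_ q qP)[h1 _]] := sgP pP; apply: h1; exact: ltW.
    rewrite mem_filter => /andP[pq pP] -> /orP[/eqP->|/mapP[p']].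
      by have [_ _ /(_ q qP)[_ h1]] := sgP pP; apply: h1; exact: ltW.
    rewrite mem_filter => /andP[qp' p'P] ->.
    by apply: sg_lt => //; rewrite -(aut_lt g^-1%g); exact: lt_trans qp'.
  exists u => _; split.
  - by apply: uA; rewrite inE eqxx.
  - by apply: uB; rewrite inE eqxx.
  - move=> p pP pq; apply: uA; rewrite inE; apply/orP; right.
    by apply: map_f; rewrite mem_filter pq.
  - move=> p pP pq; apply: uB; rewrite inE; apply/orP; right.
    by apply: map_f; rewrite mem_filter pq.
(* A point in both [P] and [g^-1 P] takes the [sg] value; the two non-strict cases of [sgP] then put
   it between [l x] and [r x]. *)
pose f x := if g x \in P then sg (g x) else tau x.
have [|b bf] := @increasing_extension _ _ Xhom (P ++ [seq g^-1%g p | p <- P]) f.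
  have inP x : g x \notin P -> x \in P ++ [seq g^-1%g p | p <- P] -> x \in P.
    move=> gx; rewrite mem_cat => /orP[//|/mapP[p pP xE]].
    by move: gx; rewrite xE gVK pP.
  move=> x y xQ yQ xy; rewrite /f.
  have [gxP|gxP] := boolP (g x \in P); have [gyP|gyP] := boolP (g y \in P).
  - by apply: sg_lt; rewrite // aut_lt.
  - have [_ _ h1 _] := tauP y (inP y gyP yQ).
    by apply: h1; rewrite // gK.
  - have [_ _ _ h1] := tauP x (inP x gxP xQ).
    by apply: h1; rewrite // gK.
  - have xP := inP x gxP xQ; have yP := inP y gyP yQ.
    have [_ xr _ _] := tauP x xP; have [yl _ _ _] := tauP y yP.
    exact: lt_trans xr (le_lt_trans (disj xP yP xy) yl).
exists b; split=> p pP.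
  rewrite bf ?mem_cat ?pP // /f; case: ifP => [gpP|/negbT gpP].
    have [_ _ /(_ p pP)] := sgP gpP; rewrite gK => -[h1 h2].
    by split; [exact: h1|exact: h2].
  by have [h1 h2 _ _] := tauP p pP.
rewrite /= bf ?mem_cat ?map_f ?orbT // /f gVK pP.
by have [h1 h2 _] := sgP pP.
Qed.

End Interpolation.

(** For [s] different from [cm_pt q], a ray ending at [cm_pt q] makes one implication vacuous; for
    equality the interval from [l q] to [r q] serves. This transfers order relations with [P] from
    [g^-1 p] to a nearby point [u]. *)
Lemma cm_nbhs_cond (P : seq X) (l r : X -> X) (s : cm X) :
  (forall p, l p < p /\ p < r p) -> exists U : set (cm X), [/\ open U, U s &
    forall t u, U t -> U u -> forall q, q \in P ->
      (cm_pt q <= t -> cm_pt (l q) < u) /\ (t <= cm_pt q -> u < cm_pt (r q))].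
Proof.
move=> lr; elim: P => [|p P [U [oU Us UP]]].
  by exists setT; split => //; exact: openT.
have [lp pr] := lr p.
have rayU c : open [set u : cm X | c < u].
  by have := @rray_open _ (cm X) c; rewrite set_itvE.
have rayL c : open [set u : cm X | u < c].
  by have := @lray_open _ (cm X) c; rewrite set_itvE.
have [V [oV Vs VP]] : exists V : set (cm X), [/\ open V, V s &
    forall t u, V t -> V u ->
      (cm_pt p <= t -> cm_pt (l p) < u) /\ (t <= cm_pt p -> u < cm_pt (r p))].
  have [sp|ps|->] := ltgtP s (cm_pt p).
  - exists [set u : cm X | u < cm_pt p]; split => // t u /= tp up; split.
      by rewrite leNgt tp.
    by move=> _; apply: lt_trans up _; rewrite cm_pt_lt.
  - exists [set u : cm X | cm_pt p < u]; split => // t u /= tp up; split.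
      by move=> _; apply: lt_trans up; rewrite cm_pt_lt.
    by rewrite leNgt tp.
  - exists ([set u : cm X | cm_pt (l p) < u] `&` [set u : cm X | u < cm_pt (r p)]).
    split; [exact: openI|by split; rewrite /= cm_pt_lt|].
    by move=> t u _ [/= lu ur]; split.
exists (U `&` V); split; [exact: openI|by []|].
move=> t u [Ut Vt] [Uu Vu] q; rewrite inE => /orP[/eqP->|]; first exact: VP.
exact: UP.
Qed.

(** The limit [zt p] of [g^-1 p] along [F] gives [(zt p, p)] in the common graph. Hence, along [F'],
    some [u] near [zt p] has [h u] between [l p] and [r p], which provides the data for
    [interpolating_aut]. *)
Lemma limit_double_coset F F' (c : b_cm X) (O A B : set (aut X)) :
  UltraFilter F -> UltraFilter F' ->
  ext_emb (b_cm X) @ F --> c -> ext_emb (b_cm X) @ F' --> c ->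
  nbhs (1%g : aut X) O -> F A -> F' B ->
  exists g h : aut X, [/\ A g, B h & double_coset O g h].
Proof.
move=> FU F'U Fc F'c nO FA F'B.
(* The right factor will be [b^-1], whereas the construction controls [b]. *)
have nO' : nbhs (1%g : aut X) (O `&` [set a : aut X | O a^-1%g]).
  apply: filterI => //.
  by apply: (@invg_continuous (aut X) 1%g); rewrite invg1.
have [P [l [r [lr disj lrO]]]] := aut_nbhs1_disjoint nO'.
have [zt ztP] : exists zt : X -> cm X, forall p,
    (fun g : aut X => cm_act g^-1%g (cm_pt p)) @ F --> zt p.
  suff /choice[zt ztP] (p : X) : exists s : cm X,
      (fun g : aut X => cm_act g^-1%g (cm_pt p)) @ F --> s by exists zt.
  have := cm_compact Xinf Xhom; rewrite compact_ultra.
  move=> /(_ ((fun g : aut X => cm_act g^-1%g (cm_pt p)) @ F)).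
  by move=> /(_ (fmap_ultra _ FU) filterT)[s [_ Fs]]; exists s.
have cz p : limit_graph c (zt p, cm_pt p).
  apply/(limit_graph_mem Xinf Xhom (zt p, cm_pt p) _ Fc) => U oU Up.
  have /= [[I J] [/= zI pJ] IJ] : nbhs (zt p, cm_pt p) U by exact: open_nbhs_nbhs.
  have FI : F [set g : aut X | I (cm_act g^-1%g (cm_pt p))] by exact: ztP.
  apply: filterS FI => g /= Ig; exists (cm_act g^-1%g (cm_pt p), cm_pt p).
  split; first by rewrite /graph /= cm_actVK.
  by apply: IJ; split => //=; exact: nbhs_singleton.
have /choice[W WP] p := cm_nbhs_cond P (zt p) lr.
have F1 : F [set g : aut X | forall p, p \in P -> W p (cm_act g^-1%g (cm_pt p))].
  apply: filter_seq => p pP; have [oW Wz _] := WP p.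
  by apply: ztP; exact: open_nbhs_nbhs.
have F2 : F' [set h : aut X | forall p, p \in P -> graph (cm_act h) `&`
    (W p `*` [set u | cm_pt (l p) < u /\ u < cm_pt (r p)]) !=set0].
  apply: filter_seq => p pP; have [oW Wz _] := WP p.
  apply: (iffLR (limit_graph_mem Xinf Xhom (zt p, cm_pt p) _ F'c)) => //.
    rewrite openE => -[u v] [/= Wu [lv vr]].
    exists (W p, [set u | cm_pt (l p) < u] `&` [set u | u < cm_pt (r p)]) => /=.
      split; first exact: open_nbhs_nbhs.
      by apply: filterI; [exact: (near_gt lv)|exact: (near_lt vr)].
    by move=> [a b] [/= ? []].
  have [lp pr] := lr p.
  by split => //=; rewrite !cm_pt_lt.
have [g [Ag Wg]] := filter_ex (filterI FA F1).
have [h [Bh Wh]] := filter_ex (filterI F'B F2).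
have /choice[sg sgP] (p : X) : exists s, p \in P -> [/\ l p < h s, h s < r p &
    forall q, q \in P -> (q <= g^-1%g p -> l q < s) /\ (g^-1%g p <= q -> s < r q)].
  have [pP|] := boolP (p \in P); last by exists p.
  have [[u v] [uv [/= Wu [lv vr]]]] := Wh p pP.
  rewrite /graph /= in uv; subst v.
  have [_ _ cond] := WP p; have {}cond := cond _ _ (Wg p pP) Wu.
  rewrite cm_act_pt in cond.
  have hl : cm_pt (h^-1%g (l p)) < u.
    by rewrite -cm_act_pt -(cm_act_lt h) cm_actVK.
  have hr : u < cm_pt (h^-1%g (r p)).
    by rewrite -cm_act_pt -(cm_act_lt h) cm_actVK.
  (* The point [u] of [c_m X] satisfies all these strict inequalities, so they are consistent and
     have a solution in [X]. *)
  have [|s [sA sB]] := seq_separation Xinf Xhom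
    (A := h^-1%g (l p) :: [seq l q | q <- P & q <= g^-1%g p])
    (B := h^-1%g (r p) :: [seq r q | q <- P & g^-1%g p <= q]).
    move=> a b aA bB; rewrite -cm_pt_lt; apply: (@lt_trans _ _ u).
      move: aA; rewrite inE => /orP[/eqP->//|/mapP[q]].
      rewrite mem_filter => /andP[qp qP] ->.
      by have [h1 _] := cond q qP; apply: h1; rewrite cm_pt_le.
    move: bB; rewrite inE => /orP[/eqP->//|/mapP[q]].
    rewrite mem_filter => /andP[qp qP] ->.
    by have [_ h1] := cond q qP; apply: h1; rewrite cm_pt_le.
  exists s => _; split=> [||q qP].
  - by rewrite -(aut_lt h^-1%g) [X in _ < X]autK; apply: sA; rewrite inE eqxx.
  - by rewrite -(aut_lt h^-1%g) [X in X < _]autK; apply: sB; rewrite inE eqxx.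
  - split=> qp.
      by apply: sA; rewrite inE; apply/orP; right; apply: map_f; rewrite mem_filter qp.
    by apply: sB; rewrite inE; apply/orP; right; apply: map_f; rewrite mem_filter qp.
have [b [bP aP]] := interpolating_aut lr disj sgP.
have [_ Ob] := lrO b bP; have [Oa _] := lrO _ aP.
exists g, h; split => //; exists (h * b * g^-1)%g => //; exists b^-1%g => //.
by rewrite mulgVK mulgK.
Qed.

Section RealField.
Variable R : realType.

Lemma roelcke_ultra_cvg F : UltraFilter F ->
  exists q : roelcke_compactification R (aut X),
    ext_emb (roelcke_compactification R (aut X)) @ F --> q.
Proof.
move=> FU.
have /choice[v vP] (f : ucb_fun R (roelcke (aut X))) : exists v : R,
    (fun g => f g) @ F --> v.
  have [M fM] := ucb_bounded f.
  have := @segment_compact R (- M)%R M; rewrite compact_ultra.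
  move=> /(_ ((fun g => f g) @ F) (fmap_ultra _ FU))[|v [_ Fv]]; last by exists v.
  suff : F [set g | (f g \in `[- M, M])%R] by [].
  by apply: filterE => g /=; rewrite in_itv /= -ler_norml; exact: fM.
have Fv : @samuel_map R (roelcke (aut X)) @ F --> (v : {ptws _ -> R}).
  by apply: ptws_cvg => f; exact: vP.
have [q _ Fq] := closure_ext_cvg _ Fv.
by exists q.
Qed.

Lemma samuel_val_cvg F (q : roelcke_compactification R (aut X))
    (f : ucb_fun R (roelcke (aut X))) : Filter F ->
  ext_emb (roelcke_compactification R (aut X)) @ F --> q ->
  (fun g : aut X => f g) @ F --> (\val q : {ptws ucb_fun R (roelcke (aut X)) -> R}) f.
Proof.
move=> FF /closure_ext_val_cvg Fq W qW.
exact: (Fq _ (@ptws_eval_continuous _ _ f _ _ qW)).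
Qed.

(** For each bounded uniformly continuous [f], some [g] and [h] have values within [e / 3] of the
    two limits and lie in a common small double coset; so the limits differ by at most [e]. *)
Lemma b_cm_ge_roelcke : ext_ge (b_cm X) (roelcke_compactification R (aut X)).
Proof.
apply: ext_ge_ultra.
- by apply: set_type_regular; exact: uniform_regular.
- exact: roelcke_ultra_cvg.
move=> F F' c q q' FU F'U Fc F'c Fq F'q'; apply/val_inj/funext => f.
have Ff : (fun g : aut X => f g) @ F --> (\val q : {ptws _ -> R}) f.
  exact: samuel_val_cvg Fq.
have F'f : (fun g : aut X => f g) @ F' --> (\val q' : {ptws _ -> R}) f.
  exact: samuel_val_cvg F'q'.
apply/eqP; rewrite -subr_eq0 -normr_le0; apply/ler_addgt0Pr => e e0; rewrite add0r.
have e3 : (0 < e / 3)%R by rewrite divr_gt0.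
have [O nO fO] : roelcke_entourage
    [set xy : roelcke (aut X) * roelcke (aut X) | ball (f xy.1) (e / 3)%R (f xy.2)].
  apply: (@ucb_unif_continuous _ _ f [set xy | ball xy.1 (e / 3)%R xy.2]).
  by rewrite /= -entourage_ballE; exists (e / 3)%R.
have F1 : F [set g : aut X | ball (\val q f) (e / 3)%R (f g)].
  by apply: Ff; exact: nbhsx_ballx.
have F2 : F' [set h : aut X | ball (\val q' f) (e / 3)%R (f h)].
  by apply: F'f; exact: nbhsx_ballx.
have [g [h [/= qg q'h gh]]] := limit_double_coset FU F'U Fc F'c nO F1 F2.
have O1 := nbhs_singleton nO.
have fgh : ball (f g) (e / 3)%R (f h).
  apply: (fO (g, h)); exists g => //; split => //=.
  by exists 1%g => //; exists 1%g; rewrite // mul1g mulg1.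
have := ball_triangle (ball_triangle qg fgh) (ball_sym q'h).
rewrite /ball /= => /ltW/le_trans; apply.
by lra.
Qed.

(** Were [f t < f' s], the two ultrafilter-side conditions [A] and [B] would be separated by a
    Roelcke entourage, hence by a bounded uniformly continuous function with different limits along
    [F] and [F']. *)
Lemma limit_graph_roelcke_sub F F' (c : roelcke_compactification R (aut X))
    (f f' : cm X -> cm X) (s t : cm X) : ProperFilter F -> ProperFilter F' ->
  ext_emb (roelcke_compactification R (aut X)) @ F --> c ->
  ext_emb (roelcke_compactification R (aut X)) @ F' --> c ->
  (forall t, (fun g => cm_act g t) @ F --> f t) ->
  (forall t, (fun g => cm_act g t) @ F' --> f' t) ->
  s < t -> f' s <= f t.
Proof.
move=> FF F'F Fc F'c Ff F'f' st; rewrite leNgt; apply/negP => ff'.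
have [x [sx xt]] := cm_lt_pt Xinf Xhom st.
have [y [+ yt]] := cm_lt_pt Xinf Xhom xt; rewrite cm_pt_lt => xy.
have [u [fu uf']] := cm_lt_pt Xinf Xhom ff'.
have [v [+ vf']] := cm_lt_pt Xinf Xhom uf'; rewrite cm_pt_lt => uv.
have [m [xm my]] := between_ex Xinf Xhom xy.
have [n [un nv]] := between_ex Xinf Xhom uv.
pose A := [set g : aut X | g y < u]; pose B := [set g : aut X | v < g x].
have FA : F A.
  have : F [set g | cm_act g t < cm_pt u] by exact: (Ff t _ (near_lt fu)).
  apply: filterS => g /= gt; rewrite /A /= -cm_pt_lt -cm_act_pt.
  by apply: lt_trans gt; rewrite cm_act_lt.
have FB : F' B.
  have : F' [set g | cm_pt v < cm_act g s] by exact: (F'f' s _ (near_gt vf')).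
  apply: filterS => g /= gt; rewrite /B /= -cm_pt_lt -cm_act_pt.
  by apply: lt_trans gt _; rewrite cm_act_lt.
(* The markers [m] and [n] halve the gaps [x < y] and [u < v]. A left factor in [O] cannot carry [n]
   past [u] or [v], and right factors in [O] keep the images of [x] and [y] on their sides of
   [m]. *)
pose O := [set a : aut X | [/\ a x < m, m < a y, u < a n & a n < v]].
have nO : nbhs (1%g : aut X) O.
  have N1 : nbhs (1%g : aut X) [set a : aut X | a x < m].
    exact: (@aut_eval_continuous _ X x 1%g _ (@near_lt _ X m x xm)).
  have N2 : nbhs (1%g : aut X) [set a : aut X | m < a y].
    exact: (@aut_eval_continuous _ X y 1%g _ (@near_gt _ X m y my)).
  have N3 : nbhs (1%g : aut X) [set a : aut X | u < a n].
    exact: (@aut_eval_continuous _ X n 1%g _ (@near_gt _ X u n un)).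
  have N4 : nbhs (1%g : aut X) [set a : aut X | a n < v].
    exact: (@aut_eval_continuous _ X n 1%g _ (@near_lt _ X v n nv)).
  by apply: filterS (filterI (filterI N1 N2) (filterI N3 N4)) => a [[? ?] [? ?]].
have sep a b : A a -> B b ->
    ~ (\bigcup_g (double_coset O g `*` double_coset O g)) (a, b).
  move=> Aa Bb [k _ [/= [a1 [_ _ ua1n _] [a2 [_ ma2y _ _] aE]]]].
  move=> [b1 [_ _ _ b1nv] [b2 [b2xm _ _ _] bE]].
  (* Cancelling the left factors gives [k (a2 y) < n < k (b2 x)], whereas [b2 x < m < a2 y]. *)
  have h1 : k (a2 y) < n.
    rewrite -(aut_lt a1); apply: lt_trans ua1n.
    by move: Aa; rewrite /A /= -aE.
  have h2 : n < k (b2 x).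
    rewrite -(aut_lt b1); apply: lt_trans b1nv _.
    by move: Bb; rewrite /B /= -bE.
  have := lt_trans h1 h2; rewrite aut_lt => /lt_trans/(_ b2xm)/lt_trans/(_ ma2y).
  by rewrite ltxx.
have Eent : @entourage (roelcke (aut X))
    (\bigcup_g (double_coset O g `*` double_coset O g)) by exists O.
have [w [e [e0 wA wB]]] := ucb_separation R Eent sep.
have Fw : (fun g : aut X => w g) @ F --> (\val c : {ptws _ -> R}) w.
  exact: samuel_val_cvg Fc.
have F'w : (fun g : aut X => w g) @ F' --> (\val c : {ptws _ -> R}) w.
  exact: samuel_val_cvg F'c.
have w0 : (fun g : aut X => w g) @ F --> (0%R : R).
  move=> W W0; suff : F [set g | W (w g)] by [].
  by apply: filterS FA => g Ag /=; rewrite (wA g Ag); exact: nbhs_singleton.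
have we : (fun g : aut X => w g) @ F' --> e.
  move=> W We; suff : F' [set g | W (w g)] by [].
  by apply: filterS FB => g Bg /=; rewrite (wB g Bg); exact: nbhs_singleton.
have c0 := cvg_unique (@Rhausdorff R) Fw w0.
have ce := cvg_unique (@Rhausdorff R) F'w we.
by move: e0; rewrite -ce c0 ltxx.
Qed.

Lemma roelcke_ge_b_cm : ext_ge (roelcke_compactification R (aut X)) (b_cm X).
Proof.
apply: ext_ge_ultra.
- exact: b_cm_regular.
- exact: b_cm_ultra_cvg.
have e_lim F (FU : UltraFilter F) : exists p : e_cm X, ext_emb (e_cm X) @ F --> p.
  have := e_cm_compact Xinf Xhom; rewrite compact_ultra.
  by move=> /(_ (ext_emb (e_cm X) @ F) (fmap_ultra _ FU) filterT)[p [_ Fp]]; exists p.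
move=> F F' c q q' FU F'U Fc F'c Fq F'q'.
have [p Fp] := e_lim F FU; have [p' F'p'] := e_lim F' F'U.
have Ff t : (fun g => cm_act g t) @ F --> \val p t by exact: e_cm_val_cvg Fp.
have F'f t : (fun g => cm_act g t) @ F' --> \val p' t by exact: e_cm_val_cvg F'p'.
apply: limit_graph_inj.
rewrite (limit_graphE Xinf Xhom _ Ff Fq) (limit_graphE Xinf Xhom _ F'f F'q').
apply: contrapT => /(completed_graph_crossing Xinf Xhom
  (e_cm_end_monotone Xinf Xhom p) (e_cm_end_monotone Xinf Xhom p')).
move=> [x [y [xy [|]]]]; rewrite ltNge => /negP; apply.
  exact: limit_graph_roelcke_sub Fc F'c Ff F'f xy.
exact: limit_graph_roelcke_sub F'c Fc F'f Ff xy.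
Qed.

End RealField.

End RoelckeGraph.

Theorem theorem5p7 (R : realType) (d : Order.disp_t)
    (X : orderTopologicalType d)
    (X_infinite : infinite_set [set: X]) (X_homogeneous : ultrahomogeneous X) :
  ext_eq (roelcke_compactification R (aut X)) (b_cm X) /\
  ext_ge (e_cm X) (b_cm X) /\
  ((exists F : b_cm X, limit_graph F = graph_A X) /\
   (exists F : b_cm X, limit_graph F = graph_B X) /\
   ext_eq (b_cX X) (collapse_extension (zero_K X)) /\
   ext_ge (b_cm X) (b_cX X)) /\
  (closed_ideal (closure (range (ellis_map (@cm_act d X)))) (I_maps X) /\
   ext_eq (e_cX X) (collapse_extension (I_ideal X)) /\
   ext_ge (e_cm X) (e_cX X)) /\
  ext_incomparable (b_cm X) (e_cX X) /\
  ext_incomparable (b_cX X) (e_cX X).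
Proof.
have e_b : ext_ge (e_cm X) (b_cm X).
  by have [h [hc he _]] := e_cm_b_cm X_infinite X_homogeneous; exists h.
have b_b : ext_ge (b_cm X) (b_cX X).
  by have [h [hc he _]] := b_cm_b_cX X_infinite X_homogeneous; exists h.
have e_e : ext_ge (e_cm X) (e_cX X).
  by have [h [hc he _]] := e_cm_e_cX X_infinite X_homogeneous; exists h.
have not_b_e := b_cm_not_ge_e_cX X_infinite X_homogeneous.
have not_e_b := e_cX_not_ge_b_cX X_infinite X_homogeneous.
split; first by split; [exact: roelcke_ge_b_cm|exact: b_cm_ge_roelcke].
split => //; split; last split; last split.
- split; first exact: limit_graph_A_ex.
  split; first exact: limit_graph_B_ex.
  by split; first exact: b_cX_collapse.
- split; first exact: I_maps_closed_ideal.
  by split; first exact: e_cX_collapse.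
(* The other two non-comparisons follow by composing with the map from [b_cm X] to [b_cX X]. *)
- split => // /ext_ge_trans/(_ b_b); exact: not_e_b.
- split => //; exact: contra_not (ext_ge_trans b_b) not_b_e.
Qed.
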